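(* Let $E=(E^0,E^1,r,s)$ be a directed graph and let $(X,\mu)$ be an $E$-branching system, with associated families $\{R_e\}_{e\in E^1}$, $\{D_v\}_{v\in E^0}$ and maps $f_e$, $f_e^{-1}$, $\Phi_{f_e}$, $\Phi_{f_e^{-1}}$ ($e\in E^1$). Then there exists a $*$-homomorphism $\pi:C^*(E)\rightarrow B(L^2(X,\mu))$ such that, for all $e\in E^1$, $v\in E^0$ and $\phi\in L^2(X,\mu)$, $$\pi(S_e)\phi=\chi_{R_e}\cdot\Phi_{f_e^{-1}}^{\frac12}\cdot(\phi\circ f_e^{-1})\qquad\text{and}\qquad \pi(P_v)\phi=\chi_{D_v}\,\phi,$$ where the first formula means that $(\pi(S_e)\phi)(x)=\Phi_{f_e^{-1}}(x)^{\frac12}\,\phi(f_e^{-1}(x))$ for $x\in R_e$ and $(\pi(S_e)\phi)(x)=0$ for $x\notin R_e$.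
   Context: A directed graph $E=(E^0,E^1,r,s)$ consists of a set $E^0$ of vertices, a set $E^1$ of edges, and range and source maps $r,s:E^1\to E^0$. The graph C*-algebra $C^*(E)$ is the universal C*-algebra generated by mutually orthogonal projections $\{P_v\}_{v\in E^0}$ and partial isometries $\{S_e\}_{e\in E^1}$ with mutually orthogonal ranges such that: $S_e^*S_e=P_{r(e)}$ for each $e\in E^1$; $S_eS_e^*\le P_{s(e)}$ for each $e\in E^1$; and $P_v=\sum_{e:s(e)=v}S_eS_e^*$ for every vertex $v$ with $0<\#\{e\in E^1: s(e)=v\}<\infty$. For measurable sets $A,B$ in a measure space $(X,\mu)$, $B\stackrel{\mu-a.e.}{\subseteq}A$ means $\mu(B\setminus A)=0$, and $A\stackrel{\mu-a.e.}{=}B$ means $\mu(A\setminus B)=\mu(B\setminus A)=0$. For maps $f,g$ on $A$, $f\stackrel{\mu-a.e.}{=}g$ means $\mu(\{x\in A: f(x)\ne g(x)\})=0$. An $E$-branching system is a measure space $(X,\mu)$ with families of measurable subsets $\{R_e\}_{e\in E^1}$, $\{D_v\}_{v\in E^0}$ of $X$, and maps $f_e,f_e^{-1},\Phi_{f_e},\Phi_{f_e^{-1}}$ ($e\in E^1$), such that: 1. $R_e\cap R_d\stackrel{\mu-a.e.}{=}\emptyset$ for all $d\neq e$ in $E^1$; 2. $D_u\cap D_v\stackrel{\mu-a.e.}{=}\emptyset$ for all $u\ne v$ in $E^0$; 3. $R_e\stackrel{\mu-a.e.}{\subseteq}D_{s(e)}$ for each $e\in E^1$; 4. $D_v\stackrel{\mu-a.e.}{=}\bigcup_{e:s(e)=v}R_e$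 whenever $0<\#\{e\in E^1:s(e)=v\}<\infty$; 5. for each $e\in E^1$, $f_e:D_{r(e)}\to R_e$ is a measurable map with $f_e(D_{r(e)})\stackrel{\mu-a.e.}{=}R_e$, and the Radon-Nikodym derivative $\Phi_{f_e}$ of $\mu\circ f_e$ with respect to $\mu$ on $D_{r(e)}$ exists (that is, $\mu(f_e(A))=\int_A\Phi_{f_e}\,d\mu$ for all measurable $A\subseteq D_{r(e)}$) and $\Phi_{f_e}>0$ $\mu$-a.e. on $D_{r(e)}$; 6. for each $e\in E^1$, $f_e^{-1}:R_e\to D_{r(e)}$ is a measurable map with $f_e\circ f_e^{-1}\stackrel{\mu-a.e.}{=}\mathrm{Id}_{R_e}$ and $f_e^{-1}\circ f_e\stackrel{\mu-a.e.}{=}\mathrm{Id}_{D_{r(e)}}$, and the Radon-Nikodym derivative $\Phi_{f_e^{-1}}$ of $\mu\circ f_e^{-1}$ with respect to $\mu$ on $R_e$ exists (that is, $\mu(f_e^{-1}(B))=\int_B\Phi_{f_e^{-1}}\,d\mu$ for all measurable $B\subseteq R_e$). $\Phi_{f_e}$ and $\Phi_{f_e^{-1}}$ are nonnegative real-valued measurable functions, extended by $0$ to $X$. $B(H)$ denotes the bounded linear operators on $H$, and $\chi_A$ the characteristic function of $A$. *)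

(* Defs.v *)
From HB Require Import structures.
From mathcomp Require Import all_boot all_order all_algebra.
From mathcomp Require Import ring_quotient generic_quotient complex.
From mathcomp Require Import all_classical all_reals all_analysis.
From mathcomp Require Import measurable_realfun.

Set Implicit Arguments.
Unset Strict Implicit.
Unset Printing Implicit Defensive.

Import Order.TTheory GRing.Theory Num.Theory.
Import numFieldNormedType.Exports.

Local Open Scope classical_set_scope.
Local Open Scope ring_scope.

Notation normc := ComplexField.Normc.normc.

Section L2fun.
Context (R : realType) (d : measure_display) (X : measurableType d).
Variable mu : {measure set X -> \bar R}.
Implicit Types f g : X -> R[i].

Definition cmeasurable f : Prop :=
  measurable_fun setT (fun x => complex.Re (f x)) /\
  measurable_fun setT (fun x => complex.Im (f x)).

Definition sq_integrable : {pred X -> R[i]} :=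
  fun f => `[< cmeasurable f /\ finite_norm mu 2%:E (fun x => normc (f x)) >].

Lemma normc_ge0 (z : R[i]) : 0 <= normc z.
Proof. by case: z => a b; exact: sqrtr_ge0. Qed.

Lemma normcC (z : R[i]) : (normc z)%:C%C = `|z|.
Proof. by []. Qed.

Lemma le_normc_add (z w : R[i]) : normc (z + w) <= normc z + normc w.
Proof. by rewrite -lecR rmorphD !normcC ler_normD. Qed.

Lemma measurable_normc f : cmeasurable f ->
  measurable_fun setT (fun x => normc (f x)).
Proof.
move=> [mr mi].
rewrite (_ : (fun x => normc (f x)) =
  (fun x => (complex.Re (f x) ^+ 2 + complex.Im (f x) ^+ 2) `^ 2^-1)); last first.
  apply/funext => x; case: (f x) => a b /=.
  by rewrite powR12_sqrt // addr_ge0 // sqr_ge0.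
apply: (@measurableT_comp _ _ _ _ _ _ (@powR R ^~ 2^-1)) => //.
by apply: measurable_funD; exact: measurable_funX.
Qed.

Lemma cmeasurable_lin (a : R[i]) f g :
  cmeasurable f -> cmeasurable g -> cmeasurable (a *: f + g).
Proof.
case: a => a b [rf jf] [rg jg]; split.
- rewrite (_ : (fun x => _) = (fun x =>
    a * complex.Re (f x) - b * complex.Im (f x) + complex.Re (g x))).
    apply: measurable_funD => //; apply: measurable_funB; exact: measurable_funM.
  by apply/funext => x; rewrite !fctE; case: (f x); case: (g x).
- rewrite (_ : (fun x => _) = (fun x =>
    a * complex.Im (f x) + b * complex.Re (f x) + complex.Im (g x))).
    apply: measurable_funD => //; apply: measurable_funD; exact: measurable_funM.
  by apply/funext => x; rewrite !fctE; case: (f x); case: (g x).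
Qed.

Lemma cmeasurable0 : cmeasurable 0.
Proof. by split; exact: measurable_cst. Qed.

Let N f := ('N[mu]_2%:E[EFin \o (fun x => normc (f x))])%E.

Lemma Lnorm2E f : N f = ((\int[mu]_x ((normc (f x) ^+ 2)%:E)) `^ 2^-1)%E.
Proof.
rewrite /N unlock /=; congr (_ `^ _)%E; apply: eq_integral => x _ /=.
by rewrite ger0_norm ?normc_ge0// powR_mulrn ?normc_ge0.
Qed.

Let mN2 f : cmeasurable f ->
  measurable_fun setT (fun x => (normc (f x) ^+ 2)%:E).
Proof.
by move=> mf; apply/measurable_EFinP; apply: measurable_funX; exact: measurable_normc.
Qed.

Let normc_sq_ge0 f x : (0 <= (normc (f x) ^+ 2)%:E)%E.
Proof. by rewrite lee_fin sqr_ge0. Qed.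

Lemma Lnorm2Z (a : R[i]) f : cmeasurable f -> N (a *: f) = ((normc a)%:E * N f)%E.
Proof.
move=> mf; rewrite !Lnorm2E.
under eq_integral do rewrite /GRing.scale/= ComplexField.Normc.normcM exprMn EFinM.
have a0 := sqr_ge0 (normc a).
rewrite (ge0_integralZl_EFin mu measurableT (fun x _ => normc_sq_ge0 f x) (mN2 mf) a0).
have I0 := integral_ge0 mu (fun x (_ : setT x) => normc_sq_ge0 f x).
rewrite (poweRM _ _ I0) ?lee_fin//.
by rewrite poweR_EFin powR12_sqrt// sqrtr_sqr ger0_norm ?normc_ge0.
Qed.

Lemma Lnorm2D f g : cmeasurable f -> cmeasurable g -> (N (f + g)%R <= N f + N g)%E.
Proof.
move=> mf mg; have h12 : 1 <= 2 :> R by rewrite ler1n.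
have mfg : cmeasurable (f + g) by rewrite -[f]scale1r; exact: cmeasurable_lin.
apply: le_trans (minkowski_EFin mu (measurable_normc mf) (measurable_normc mg) h12).
rewrite Lnorm2E unlock /=.
have I0 h : (0 <= \int[mu]_x (normc (h x) ^+ 2)%:E)%E.
  exact: integral_ge0.
apply: gt0_ler_poweR => //.
- by rewrite in_itv/= I0 leey.
- rewrite in_itv/= leey andbT; apply: integral_ge0 => x _.
  by rewrite lee_fin powR_ge0.
apply: ge0_le_integral => //.
- exact: mN2.
- apply/measurable_EFinP.
  apply: (@measurableT_comp _ _ _ _ _ _ (@powR R ^~ 2)) => //.
  apply: measurableT_comp => //.
  by apply: measurable_funD; exact: measurable_normc.
- move=> x _; rewrite lee_fin ger0_norm ?addr_ge0 ?normc_ge0//.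
  rewrite powR_mulrn ?addr_ge0 ?normc_ge0//.
  by rewrite lerXn2r ?nnegrE ?addr_ge0 ?normc_ge0// le_normc_add.
Qed.

Lemma sq_integrable_submod : submod_closed sq_integrable.
Proof.
split.
  apply/asboolP; split; first exact: cmeasurable0.
  rewrite /finite_norm (_ : _ \o _ = cst 0%E) ?Lnorm0 ?eqe//.
  by apply/funext => x; exact: (congr1 EFin (ComplexField.Normc.normc0 R)).
move=> a f g /asboolP[mf lf] /asboolP[mg lg]; apply/asboolP; split.
  exact: cmeasurable_lin.
have maf : cmeasurable (a *: f).
  by rewrite -[_ *: _]addr0; apply: cmeasurable_lin => //; exact: cmeasurable0.
apply: (le_lt_trans (Lnorm2D maf mg)); rewrite lte_add_pinfty//.
by rewrite (Lnorm2Z _ mf) lte_mul_pinfty// lee_fin normc_ge0.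
Qed.

HB.instance Definition _ :=
  GRing.isSubmodClosed.Build R[i] (X -> R[i]) sq_integrable sq_integrable_submod.

Record L2fun : Type := MkL2fun {
  L2fun_val :> X -> R[i];
  _ : L2fun_val \in sq_integrable }.

HB.instance Definition _ := [isSub for L2fun_val].
HB.instance Definition _ := gen_eqMixin L2fun.
HB.instance Definition _ := gen_choiceMixin L2fun.
HB.instance Definition _ := [SubChoice_isSubLmodule of L2fun by <:].

End L2fun.

Section L2.
Context (R : realType) (d : measure_display) (X : measurableType d).
Variable mu : {measure set X -> \bar R}.
Implicit Types f g : L2fun mu.

Definition ae_zero : {pred L2fun mu} :=
  fun f => `[< {ae mu, forall x, f x = 0} >].

Lemma ae_zeroZ (a : R[i]) f : f \in ae_zero -> a *: f \in ae_zero.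
Proof.
move=> /asboolP f0; apply/asboolP; apply: filterS f0 => x f0.
by rewrite [LHS]/(a * f x) f0; exact: mulr0.
Qed.

Lemma ae_zero_zmod : zmod_closed ae_zero.
Proof.
split=> [|f g /asboolP f0 /asboolP g0]; apply/asboolP; first exact: nearW.
apply: filterS2 f0 g0 => x f0 g0.
by rewrite [LHS]/(f x - g x) f0 g0; exact: (subr0 (0 : R[i])).
Qed.

HB.instance Definition _ :=
  GRing.isZmodClosed.Build (L2fun mu) ae_zero ae_zero_zmod.

Local Open Scope quotient_scope.

Definition L2 : Type := Quotient.quot ae_zero.

HB.instance Definition _ := GRing.Zmodule.on L2.
HB.instance Definition _ := EqQuotient.on L2.

Definition L2class f : L2 := \pi_L2 f.
Definition L2repr (phi : L2) : L2fun mu := repr phi.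
Coercion L2repr : L2 >-> L2fun.

Lemma L2reprK (phi : L2) : L2class phi = phi.
Proof. exact: reprK. Qed.

Lemma L2class_eqP f g :
  reflect ({ae mu, forall x, f x = g x}) (L2class f == L2class g).
Proof.
rewrite /L2class -(Quotient.idealrBE ae_zero).
apply: (iffP (asboolP _)); apply: filterS => x.
  by move=> /eqP; rewrite [_ x]/(f x - g x) subr_eq0 => /eqP.
by move=> fg; rewrite [LHS]/(f x - g x) fg; exact: (subrr (g x)).
Qed.

Lemma L2class_repr f : {ae mu, forall x, L2class f x = f x}.
Proof. by apply/L2class_eqP; rewrite L2reprK. Qed.

Lemma L2classD f g : L2class (f + g) = L2class f + L2class g.
Proof. by rewrite /L2class !piE. Qed.

Definition L2scale (a : R[i]) (phi : L2) : L2 := L2class (a *: L2repr phi).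

Lemma L2classZ (a : R[i]) f : L2class (a *: f) = L2scale a (L2class f).
Proof.
apply/eqP/L2class_eqP; apply: filterS (L2class_repr f) => x fx.
by rewrite [LHS]/(a * f x) [RHS]/(a * L2class f x) fx.
Qed.

Lemma L2scaleA (a b : R[i]) phi : L2scale a (L2scale b phi) = L2scale (a * b) phi.
Proof. by rewrite -[phi]L2reprK -!L2classZ scalerA. Qed.

Lemma L2scale1 : left_id 1 L2scale.
Proof. by move=> phi; rewrite /L2scale scale1r L2reprK. Qed.

Lemma L2scaleDr : right_distributive L2scale +%R.
Proof.
move=> a phi psi; rewrite -[phi]L2reprK -[psi]L2reprK -L2classD -!L2classZ.
by rewrite scalerDr L2classD.
Qed.

Lemma L2scaleDl phi : {morph L2scale^~ phi : a b / a + b}.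
Proof.
by move=> a b; rewrite -[phi]L2reprK -!L2classZ scalerDl L2classD.
Qed.

HB.instance Definition _ := GRing.Zmodule_isLmodule.Build R[i] L2
  L2scaleA L2scale1 L2scaleDr L2scaleDl.

Definition L2norm (phi : L2) : R[i] :=
  (fine 'N[mu]_2%:E[EFin \o (fun x => normc (phi x))]%E)%:C%C.

Let N (f : X -> R[i]) := ('N[mu]_2%:E[EFin \o (fun x => normc (f x))])%E.

Lemma L2fun_cmeas f : cmeasurable f.
Proof. by case: f => f /= /asboolP[]. Qed.

Lemma L2fun_finite f : (N f < +oo)%E.
Proof. by case: f => f /= /asboolP[]. Qed.

Lemma L2fun_fineK f : (fine (N f))%:E = N f.
Proof. by rewrite fineK// ge0_fin_numE ?L2fun_finite// Lnorm_ge0. Qed.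

Lemma L2norm_class f : L2norm (L2class f) = (fine (N f))%:C%C.
Proof.
suff E : N (L2class f) = N f by rewrite /L2norm -/(N _) E.
rewrite [LHS](Lnorm2E mu (L2class f)) [RHS](Lnorm2E mu f); congr (_ `^ _)%E.
have mN (h : L2fun mu) : measurable_fun setT (fun x => (normc (h x) ^+ 2)%:E).
  apply/measurable_EFinP/measurable_funX/measurable_normc; exact: L2fun_cmeas.
apply: ae_eq_integral => //.
by apply: filterS (L2class_repr f) => x -> _.
Qed.

Lemma L2norm_triangle (phi psi : L2) : L2norm (phi + psi) <= L2norm phi + L2norm psi.
Proof.
rewrite -[phi]L2reprK -[psi]L2reprK -L2classD !L2norm_class -rmorphD lecR.
rewrite -lee_fin EFinD !L2fun_fineK.
by apply: Lnorm2D; exact: L2fun_cmeas.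
Qed.

Lemma L2normZ (a : R[i]) (phi : L2) : L2norm (a *: phi) = `|a| * L2norm phi.
Proof.
rewrite -[phi]L2reprK -[_ *: _]L2classZ !L2norm_class -normcC -rmorphM.
congr (_%:C)%C; apply: EFin_inj; rewrite EFinM !L2fun_fineK.
exact: Lnorm2Z (L2fun_cmeas _).
Qed.

Lemma L2norm_eq0 (phi : L2) : L2norm phi = 0 -> phi = 0.
Proof.
move=> phi0; have {phi0}h : N phi = 0%E.
  by rewrite -L2fun_fineK; congr EFin; exact: (congr1 (@complex.Re R) phi0).
have mphi := iffRL (measurable_EFinP _ _) (measurable_normc (L2fun_cmeas phi)).
have h2 : (0 < 2%:E :> \bar R)%E by rewrite lte_fin.
have {}h := Lnorm_eq0_eq0 mphi h2 h.
rewrite -[phi]L2reprK -[RHS]L2reprK; apply/eqP/L2class_eqP.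
have z : {ae mu, forall x, (0 : L2) x = 0}.
  have -> : (0 : L2) = L2class 0 by rewrite /L2class piE.
  exact: L2class_repr.
apply: filterS2 h z => x /(_ I)[] /ComplexField.Normc.eq0_normc -> ->.
by [].
Qed.

HB.instance Definition _ := Lmodule_isNormed.Build R[i] L2
  L2norm_triangle L2normZ L2norm_eq0.

Definition dot (phi psi : L2) : R[i] :=
  let h x := phi x * (psi x)^*%C in
  ((\int[mu]_x complex.Re (h x))%R +i* (\int[mu]_x complex.Im (h x))%R)%C.

End L2.

Record bounded_operator (K : numFieldType) (H : normedModType K) : Type :=
  MkBoundedOperator {
    bounded_operator_fun :> {linear H -> H};
    _ : exists M : K, forall x, `|bounded_operator_fun x| <= M * `|x| }.

HB.mixin Record CompleteNormedModule_isCStarAlgebra (R : realType) A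
    of CompleteNormedModule R[i] A := {
  cmul : A -> A -> A;
  cstar : A -> A;
  cmulA : associative cmul;
  cmulDl : left_distributive cmul +%R;
  cmulDr : right_distributive cmul +%R;
  cmulZl : forall (c : R[i]) x y, cmul (c *: x) y = c *: cmul x y;
  cmulZr : forall (c : R[i]) x y, cmul x (c *: y) = c *: cmul x y;
  cstarK : involutive cstar;
  cstarD : {morph cstar : x y / x + y};
  cstarZ : forall (c : R[i]) x, cstar (c *: x) = c^*%C *: cstar x;
  cstarM : forall x y, cstar (cmul x y) = cmul (cstar y) (cstar x);
  cnormM : forall x y, `|cmul x y| <= `|x| * `|y|;
  cnorm_cstar : forall x, `|cmul (cstar x) x| = `|x| ^+ 2
}.

#[short(type="cstarType")]
HB.structure Definition CStarAlgebra (R : realType) :=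
  {A of CompleteNormedModule R[i] A & CompleteNormedModule_isCStarAlgebra R A}.

Record digraph : Type := Digraph {
  vertex : choiceType;
  edge : choiceType;
  rng : edge -> vertex;
  src : edge -> vertex }.

Definition out_edges (E : digraph) (v : vertex E) : set (edge E) :=
  [set e | src e = v].

Definition regular_vertex (E : digraph) (v : vertex E) : Prop :=
  out_edges v !=set0 /\ finite_set (out_edges v).

Section graph_algebra.
Context (R : realType).
Implicit Types A B : cstarType R.

Definition cprojection A (p : A) : Prop := cstar p = p /\ cmul p p = p.

Definition partial_isometry A (s : A) : Prop := cmul (cmul s (cstar s)) s = s.

Definition cpositive A (a : A) : Prop := exists c : A, a = cmul (cstar c) c.

Definition range_proj A (s : A) : A := cmul s (cstar s).

Record ck_family (E : digraph) A (P : vertex E -> A) (S : edge E -> A) : Prop :=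
  CKFamily {
    ck_projection : forall v, cprojection (P v);
    ck_orthogonal : forall u v, u <> v -> cmul (P u) (P v) = 0;
    ck_partial_isometry : forall e, partial_isometry (S e);
    ck_ranges : forall e d, e <> d ->
      cmul (range_proj (S e)) (range_proj (S d)) = 0;
    ck_rng : forall e, cmul (cstar (S e)) (S e) = P (rng e);
    ck_src : forall e, cpositive (P (src e) - range_proj (S e));
    ck_sum : forall v, regular_vertex v ->
      P v = \sum_(e \in out_edges v) range_proj (S e) }.

Record star_hom A B (h : A -> B) : Prop := StarHom {
  star_homD : forall a b, h (a + b) = h a + h b;
  star_homZ : forall (c : R[i]) a, h (c *: a) = c *: h a;
  star_homM : forall a b, h (cmul a b) = cmul (h a) (h b);
  star_homS : forall a, h (cstar a) = cstar (h a) }.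

Record star_subalgebra A (C : set A) : Prop := StarSubalgebra {
  star_subalgebra0 : C 0;
  star_subalgebraD : forall a b, C a -> C b -> C (a + b);
  star_subalgebraZ : forall (c : R[i]) a, C a -> C (c *: a);
  star_subalgebraM : forall a b, C a -> C b -> C (cmul a b);
  star_subalgebraS : forall a, C a -> C (cstar a) }.

(* C*(E) is determined up to isomorphism by its universal property:
   [graph_cstar_algebra P S] says that A, with the generators P and S, has it. *)
Record graph_cstar_algebra (E : digraph) A
    (P : vertex E -> A) (S : edge E -> A) : Prop := GraphCStarAlgebra {
  gca_family : ck_family P S;
  gca_generated : forall C : set A, star_subalgebra C -> closed C ->
    (forall v, C (P v)) -> (forall e, C (S e)) -> C = setT;
  gca_universal : forall B (Q : vertex E -> B) (T : edge E -> B),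
    ck_family Q T ->
    exists h : A -> B,
      [/\ star_hom h, forall v, h (P v) = Q v & forall e, h (S e) = T e] }.

End graph_algebra.

(* A *-homomorphism into B(L^2(X, mu)), where the involution of B(L^2(X, mu))
   is the Hilbert space adjoint. *)
Record star_rep (R : realType) (d : measure_display) (X : measurableType d)
    (mu : {measure set X -> \bar R}) (A : cstarType R)
    (pi : A -> bounded_operator (L2 mu)) : Prop := StarRep {
  star_repD : forall a b phi, pi (a + b) phi = pi a phi + pi b phi;
  star_repZ : forall (c : R[i]) a phi, pi (c *: a) phi = c *: pi a phi;
  star_repM : forall a b phi, pi (cmul a b) phi = pi a (pi b phi);
  star_repS : forall a phi psi,
    dot (pi (cstar a) phi) psi = dot phi (pi a psi) }.

Section branching_system.
Context (R : realType) (d : measure_display) (X : measurableType d).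
Variable mu : {measure set X -> \bar R}.

Definition ae_subset (B A : set X) : Prop := mu (B `\` A) = 0%E.

Definition ae_seteq (A B : set X) : Prop := ae_subset A B /\ ae_subset B A.

(* Phi is the Radon-Nikodym derivative of mu \o f with respect to mu on D,
   extended by 0.  That mu \o f is defined on the measurable subsets of D
   includes the measurability of their images, which is stated explicitly
   because mu takes unspecified values on non-measurable sets. *)
Record is_RN_derivative (D : set X) (f : X -> X) (Phi : X -> R) : Prop :=
  IsRNDerivative {
    RN_measurable : measurable_fun setT Phi;
    RN_ge0 : forall x, 0 <= Phi x;
    RN_out : forall x, ~ D x -> Phi x = 0;
    RN_image : forall A, measurable A -> A `<=` D -> measurable (f @` A);
    RN_integral : forall A, measurable A -> A `<=` D ->
      mu (f @` A) = (\int[mu]_(x in A) (Phi x)%:E)%E }.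

(* The partial maps f_e and f_e^{-1} are represented by total functions, whose
   values outside D_{r(e)}, resp. R_e, are irrelevant. *)
Record branching_system (E : digraph) : Type := BranchingSystem {
  bR : edge E -> set X;
  bD : vertex E -> set X;
  bf : edge E -> X -> X;
  bfinv : edge E -> X -> X;
  bPhi : edge E -> X -> R;
  bPhiinv : edge E -> X -> R;
  bR_measurable : forall e, measurable (bR e);
  bD_measurable : forall v, measurable (bD v);
  bR_disjoint : forall e d, d <> e -> ae_seteq (bR e `&` bR d) set0;
  bD_disjoint : forall u v, u <> v -> ae_seteq (bD u `&` bD v) set0;
  bR_src : forall e, ae_subset (bR e) (bD (src e));
  bD_regular : forall v, regular_vertex v ->
    ae_seteq (bD v) (\bigcup_(e in out_edges v) bR e);
  bf_fun : forall e, set_fun (bD (rng e)) (bR e) (bf e);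
  bf_measurable : forall e, measurable_fun (bD (rng e)) (bf e);
  bf_onto : forall e, ae_seteq (bf e @` bD (rng e)) (bR e);
  bf_RN : forall e, is_RN_derivative (bD (rng e)) (bf e) (bPhi e);
  bPhi_gt0 : forall e, {ae mu, forall x, bD (rng e) x -> 0 < bPhi e x};
  bfinv_fun : forall e, set_fun (bR e) (bD (rng e)) (bfinv e);
  bfinv_measurable : forall e, measurable_fun (bR e) (bfinv e);
  bf_bfinv : forall e, {ae mu, forall x, bR e x -> bf e (bfinv e x) = x};
  bfinv_bf : forall e, {ae mu, forall x, bD (rng e) x -> bfinv e (bf e x) = x};
  bfinv_RN : forall e, is_RN_derivative (bR e) (bfinv e) (bPhiinv e) }.

End branching_system.

(* Main.v *)
Require Import Defs.
From HB Require Import structures.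
From mathcomp Require Import all_boot all_order all_algebra.
From mathcomp Require Import finmap complex ring lra.
From mathcomp Require Import all_classical all_reals all_analysis.
From mathcomp Require Import measurable_realfun.

Set Implicit Arguments.
Unset Strict Implicit.
Unset Printing Implicit Defensive.

Import Order.TTheory GRing.Theory Num.Theory.
Import numFieldNormedType.Exports.

Local Open Scope classical_set_scope.
Local Open Scope ring_scope.

(* The bounded operators on L^2(X, mu) that have an adjoint form a C*-algebra,
   so by universality of C*(E) it suffices to find a Cuntz-Krieger family in it.
   Let S_e be the weighted composition operator of the statement and S_e' the
   same operator built from f_e and Phi_(f_e).  The change of variables formula
   makes S_e isometric on the functions supported in D_(r(e)) and S_e' on those
   supported in R_e, and each composite of the two is multiplication by a
   characteristic function; polarization then gives S_e' = S_e^*.  The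
   Cuntz-Krieger relations thus become relations between characteristic
   functions. *)

(** * The C*-algebra of adjointable operators *)

(** Working with operators that carry their adjoint as data makes the involution an exchange of two
    fields, and a [*]-homomorphism into [B(L^2)] is then obtained by forgetting the adjoint. A
    [cstarType] must be complete, which is why the completeness of [L^2] is proved: limits of
    operators and of adjoints are taken there pointwise. The measure is arbitrary, and this shapes
    the rest. On a part of [D_(r(e))] that is not sigma-finite, [Phi_(f_e)] and
    [Phi_(f_e^{-1}) \o f_e] need not be inverse to each other, so the composites are computed on one
    function of [L^2] at a time, a product of densities mattering only where that function does not
    vanish. Compatibility with almost everywhere equality is drawn from norm estimates instead of a
    study of null sets under the maps. *)

(** A structure on a space that is already normed, tied to its norm by [ip_norm], because [L2 mu]
    comes with a norm of its own. *)
Record inner_product (R : realType) (H : normedModType R[i]) : Type :=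
  InnerProduct {
    ip :> H -> H -> R[i];
    ipDl : forall x y z, ip (x + y) z = ip x z + ip y z;
    ipZl : forall (a : R[i]) x y, ip (a *: x) y = a * ip x y;
    ipC : forall x y, ip y x = (ip x y)^*%C;
    ip_norm : forall x, ip x x = `|x| ^+ 2 }.

Section inner_product_theory.
Context (R : realType) (H : normedModType R[i]) (ip : inner_product H).
Implicit Types (x y z : H) (a : R[i]).

Lemma ipDr x y z : ip x (y + z) = ip x y + ip x z.
Proof. by rewrite ipC ipDl rmorphD /= -!ipC. Qed.

Lemma ipZr a x y : ip x (a *: y) = a^*%C * ip x y.
Proof. by rewrite ipC ipZl rmorphM /= -ipC. Qed.

Lemma ip0l x : ip 0 x = 0.
Proof. by rewrite -[0](scale0r (0 : H)) ipZl mul0r. Qed.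

Lemma ipNl x y : ip (- x) y = - ip x y.
Proof. by rewrite -scaleN1r ipZl mulN1r. Qed.

Lemma ipNr x y : ip x (- y) = - ip x y.
Proof. by rewrite ipC ipNl rmorphN /= -ipC. Qed.

Lemma ipBl x y z : ip (x - y) z = ip x z - ip y z.
Proof. by rewrite ipDl ipNl. Qed.

Lemma ipBr x y z : ip x (y - z) = ip x y - ip x z.
Proof. by rewrite ipDr ipNr. Qed.

Lemma ip_eq0 x : ip x x = 0 -> x = 0.
Proof. by rewrite ip_norm => /eqP; rewrite sqrf_eq0 normr_eq0 => /eqP. Qed.

Lemma ip_ext x y : (forall z, ip x z = ip y z) -> x = y.
Proof.
by move=> xy; apply/eqP; rewrite -subr_eq0; apply/eqP/ip_eq0; rewrite ipBl xy subrr.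
Qed.

Lemma cauchy_schwarz x y : `|ip x y| <= `|x| * `|y|.
Proof.
have [->|y0] := eqVneq y 0; first by rewrite ipC ip0l rmorph0 !normr0 mulr0.
have ny : 0 < `|y| by rewrite normr_gt0.
(* [c *: y] is the orthogonal projection of [x] on the line of [y]; the squared norm of the
   remainder is [|x|^2 - |ip x y|^2 / |y|^2]. *)
set c := ip x y / `|y| ^+ 2.
have nyR : (`|y| ^+ 2)^*%C = `|y| ^+ 2 by rewrite -(ip_norm ip) -ipC.
have : 0 <= ip (x - c *: y) (x - c *: y) by rewrite ip_norm exprn_ge0.
rewrite ipBl !ipBr !ipZl !ipZr !(ip_norm _ x) !(ip_norm _ y) (ipC _ x y).
have -> : c^*%C = (ip x y)^*%C / `|y| ^+ 2 by rewrite rmorphM /= fmorphV /= nyR.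
have -> : `|x| ^+ 2 - (ip x y)^*%C / `|y| ^+ 2 * ip x y -
   (c * (ip x y)^*%C - c * ((ip x y)^*%C / `|y| ^+ 2 * `|y| ^+ 2)) =
   `|x| ^+ 2 - `|ip x y| ^+ 2 / `|y| ^+ 2.
  rewrite divfK ?sqrf_eq0 ?gt_eqF// subrr subr0 sqr_normc.
  by rewrite mulrAC [_^*%C * _]mulrC.
rewrite subr_ge0 ler_pdivrMr ?exprn_gt0// -exprMn.
by rewrite ler_pXn2r// nnegrE ?mulr_ge0.
Qed.

Lemma polarization x y : ip x y =
  4^-1 * (`|x + y| ^+ 2 - `|x - y| ^+ 2
    + 'i%C * (`|x + 'i%C *: y| ^+ 2 - `|x - 'i%C *: y| ^+ 2)).
Proof.
(* For [v = y] this is twice [ip x y + ip y x]; for [v = 'i *: y], after multiplication by ['i], it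
   is twice [ip x y - ip y x]. The sum is [4 * ip x y]. *)
have diff u v : `|u + v| ^+ 2 - `|u - v| ^+ 2 = 2 * (ip u v + ip v u).
  by rewrite -!(ip_norm ip) ipBl !ipBr !ipDl !ipDr; ring.
have ci : ('i%C)^*%C = - 'i%C :> R[i] by rewrite -[RHS]/(_ +i* _)%C oppr0.
rewrite !diff ipZl ipZr ci.
have -> : 2 * (ip x y + ip y x) + 'i%C * (2 * (- 'i%C * ip x y + 'i%C * ip y x)) =
   2 * (ip x y + ip y x) + 2 * ('i%C ^+ 2 * (ip y x - ip x y)) by ring.
rewrite sqr_i.
have -> : 2 * (ip x y + ip y x) + 2 * (-1 * (ip y x - ip x y)) = 4 * ip x y by ring.
by rewrite mulKf// pnatr_eq0.
Qed.

End inner_product_theory.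

(** Linearity is not a field: an operator with an adjoint is linear because the inner product
    separates points ([opD], [opZ]). *)
Record adjop (R : realType) (H : normedModType R[i]) (ip : inner_product H) : Type :=
  AdjOp {
    op : H -> H;
    adj : H -> H;
    adjP : forall x y, ip (op x) y = ip x (adj y);
    op_bounded : exists M : R, forall x, `|op x| <= M%:C%C * `|x| }.

Section adjop_theory.
Context (R : realType) (H : normedModType R[i]) (ip : inner_product H).
Implicit Types (T U V : adjop ip) (x y z : H) (a : R[i]).

Lemma adjPr T x y : ip (adj T x) y = ip x (op T y).
Proof. by rewrite ipC -adjP -ipC. Qed.

(** An adjoint is unique and the remaining fields are proofs, so Leibniz equality can serve as the
    equality of the algebra. *)
Lemma adjop_ext T U : op T =1 op U -> T = U.
Proof.
case: T U => [f f' ff' bf] [g g' gg' bg] /= /funext fg; subst g.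
have fg' : f' = g'.
  apply/funext => x; apply: (ip_ext (ip := ip)) => z.
  by rewrite ipC [RHS]ipC -ff' -gg'.
subst g'; congr AdjOp; exact: Prop_irrelevance.
Qed.

Lemma opD T : {morph op T : x y / x + y}.
Proof.
by move=> x y; apply: (ip_ext (ip := ip)) => z; rewrite adjP !ipDl !adjP.
Qed.

Lemma opZ T a : {morph op T : x / a *: x}.
Proof.
by move=> x; apply: (ip_ext (ip := ip)) => z; rewrite adjP !ipZl !adjP.
Qed.

Definition opnorm T : R :=
  inf [set M : R | 0 <= M /\ forall x, `|op T x| <= M%:C%C * `|x|].

Lemma op_bound_has_inf T :
  has_inf [set M : R | 0 <= M /\ forall x, `|op T x| <= M%:C%C * `|x|].
Proof.
split; last by exists 0 => M [].
have [M hM] := op_bounded T; exists `|M|; split=> // x.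
apply: le_trans (hM x) _; apply: ler_wpM2r => //.
by rewrite lecR ler_norm.
Qed.

Lemma opnorm_ge0 T : 0 <= opnorm T.
Proof. by apply: lb_le_inf => [|M []//]; have [] := op_bound_has_inf T. Qed.

Lemma opnorm_le T (M : R[i]) :
  0 <= M -> (forall x, `|op T x| <= M * `|x|) -> (opnorm T)%:C%C <= M.
Proof.
(* In [R[i]] the inequality [0 <= M] forces [M] to be real, hence to be the image of its real
   part. *)
move=> M0 hM; rewrite -(RRe_real (ger0_real M0)) lecR.
apply: ge_inf; first by have [] := op_bound_has_inf T.
split; first by rewrite -lecR (RRe_real (ger0_real M0)).
by move=> x; rewrite (RRe_real (ger0_real M0)).
Qed.

(** The infimum of the bounds is itself a bound: for [x] nonzero, [|T x| / |x|] lies below every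
    bound. *)
Lemma le_opnorm T x : `|op T x| <= (opnorm T)%:C%C * `|x|.
Proof.
have [->|x0] := eqVneq x 0.
  by rewrite -(scale0r (0 : H)) opZ !scale0r !normr0 mulr0.
have nx : 0 < `|x| by rewrite normr_gt0.
rewrite -ler_pdivrMr//.
have r0 : 0 <= `|op T x| / `|x| by rewrite divr_ge0.
rewrite -(RRe_real (ger0_real r0)) lecR.
apply: lb_le_inf => [|M [M0 hM]]; first by have [] := op_bound_has_inf T.
by rewrite -lecR (RRe_real (ger0_real r0)) ler_pdivrMr.
Qed.

(** From [|T^* x|^2 = ip x (T T^* x) <= |x| |T| |T^* x|], divided by [|T^* x|]. It makes the adjoint
    a bounded operator too, so that the involution stays inside [adjop]. *)
Lemma le_opnorm_adj T x : `|adj T x| <= (opnorm T)%:C%C * `|x|.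
Proof.
have [->|x0] := eqVneq (adj T x) 0.
  by rewrite normr0 mulr_ge0// ler0c opnorm_ge0.
have nx : 0 < `|adj T x| by rewrite normr_gt0.
rewrite -(ler_pM2r nx) -expr2 -(ip_norm ip) adjPr.
have := cauchy_schwarz ip x (op T (adj T x)).
rewrite ger0_norm -?adjPr ?ip_norm ?exprn_ge0// => /le_trans; apply.
by rewrite mulrAC mulrC ler_wpM2r// le_opnorm.
Qed.

Definition adjop_star T : adjop ip :=
  AdjOp (adjPr T) (ex_intro _ (opnorm T) (le_opnorm_adj T)).


Program Definition adjop_comp T U : adjop ip :=
  @AdjOp _ _ _ (op T \o op U) (adj U \o adj T) _ _.
Next Obligation. by move=> T U x y /=; rewrite !adjP. Qed.
Next Obligation.
move=> T U; exists (opnorm T * opnorm U) => x /=.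
apply: le_trans (le_opnorm _ _) _; rewrite rmorphM /= -mulrA ler_wpM2l ?ler0c ?opnorm_ge0//.
exact: le_opnorm.
Qed.

Program Definition adjop0 : adjop ip := @AdjOp _ _ _ (fun=> 0) (fun=> 0) _ _.
Next Obligation. by move=> x y /=; rewrite ip0l ipC ip0l rmorph0. Qed.
Next Obligation. by exists 0 => x; rewrite normr0 mul0r. Qed.

Program Definition adjop_add T U : adjop ip :=
  @AdjOp _ _ _ (fun x => op T x + op U x) (fun x => adj T x + adj U x) _ _.
Next Obligation. by move=> T U x y /=; rewrite ipDl ipDr !adjP. Qed.
Next Obligation.
move=> T U; exists (opnorm T + opnorm U) => x /=.
rewrite rmorphD mulrDl; apply: le_trans (ler_normD _ _) _.
by apply: lerD; exact: le_opnorm.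
Qed.

Program Definition adjop_scale a T : adjop ip :=
  @AdjOp _ _ _ (fun x => a *: op T x) (fun x => a^*%C *: adj T x) _ _.
Next Obligation. by move=> a T x y /=; rewrite ipZl ipZr conjcK !adjP. Qed.
Next Obligation.
move=> a T; exists (normc a * opnorm T) => x /=.
rewrite rmorphM normrZ -mulrA; apply: ler_wpM2l => //; exact: le_opnorm.
Qed.

HB.instance Definition _ := gen_eqMixin (adjop ip).
HB.instance Definition _ := gen_choiceMixin (adjop ip).

Fact adjop_addA : associative adjop_add.
Proof. by move=> T U V; apply: adjop_ext => x /=; rewrite addrA. Qed.
Fact adjop_addC : commutative adjop_add.
Proof. by move=> T U; apply: adjop_ext => x /=; rewrite addrC. Qed.
Fact adjop_add0 : left_id adjop0 adjop_add.
Proof. by move=> T; apply: adjop_ext => x /=; rewrite add0r. Qed.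
Fact adjop_addN : left_inverse adjop0 (adjop_scale (-1)) adjop_add.
Proof. by move=> T; apply: adjop_ext => x /=; rewrite scaleN1r addNr. Qed.

HB.instance Definition _ := GRing.isZmodule.Build (adjop ip)
  adjop_addA adjop_addC adjop_add0 adjop_addN.

Fact adjop_scaleA a b T : adjop_scale a (adjop_scale b T) = adjop_scale (a * b) T.
Proof. by apply: adjop_ext => x /=; rewrite scalerA. Qed.
Fact adjop_scale1 : left_id 1 adjop_scale.
Proof. by move=> T; apply: adjop_ext => x /=; rewrite scale1r. Qed.
Fact adjop_scaleDr : right_distributive adjop_scale +%R.
Proof. by move=> a T U; apply: adjop_ext => x /=; rewrite scalerDr. Qed.
Fact adjop_scaleDl T : {morph adjop_scale^~ T : a b / a + b}.
Proof. by move=> a b; apply: adjop_ext => x /=; rewrite scalerDl. Qed.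

HB.instance Definition _ := GRing.Zmodule_isLmodule.Build R[i] (adjop ip)
  adjop_scaleA adjop_scale1 adjop_scaleDr adjop_scaleDl.

Lemma op_add T U x : op (T + U) x = op T x + op U x. Proof. by []. Qed.
Lemma op_scale a T x : op (a *: T) x = a *: op T x. Proof. by []. Qed.
Lemma op_opp T x : op (- T) x = - op T x. Proof. exact: scaleN1r. Qed.
Lemma adj_add T U x : adj (T + U) x = adj T x + adj U x. Proof. by []. Qed.
Lemma adj_opp T x : adj (- T) x = - adj T x.
Proof.
have -> : adj (- T) x = (-1)^*%C *: adj T x by [].
have -> : (-1 : R[i])^*%C = -1 by apply/eqP; rewrite eq_complex /= !oppr0 !eqxx.
exact: scaleN1r.
Qed.

Definition adjop_norm T : R[i] := (opnorm T)%:C%C.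

Lemma adjop_norm_ge0 T : 0 <= adjop_norm T.
Proof. by rewrite ler0c opnorm_ge0. Qed.

Fact adjop_normD T U : adjop_norm (T + U) <= adjop_norm T + adjop_norm U.
Proof.
apply: opnorm_le => [|x]; first by rewrite addr_ge0// adjop_norm_ge0.
rewrite mulrDl; apply: le_trans (ler_normD _ _) _.
by apply: lerD; exact: le_opnorm.
Qed.

Fact adjop_norm0 T : adjop_norm T = 0 -> T = 0.
Proof.
move=> T0; apply: adjop_ext => x /=; apply/eqP; rewrite -normr_le0.
by have := le_opnorm T x; rewrite -/(adjop_norm T) T0 mul0r.
Qed.

Fact adjop_normZ a T : adjop_norm (a *: T) = `|a| * adjop_norm T.
Proof.
apply/eqP; rewrite eq_le; apply/andP; split.
  apply: opnorm_le => [|x]; first by rewrite mulr_ge0// adjop_norm_ge0.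
  by rewrite op_scale normrZ -mulrA ler_wpM2l//; exact: le_opnorm.
have [->|a0] := eqVneq a 0; first by rewrite normr0 mul0r adjop_norm_ge0.
have na : 0 < `|a| by rewrite normr_gt0.
rewrite mulrC -ler_pdivlMr//; apply: opnorm_le => [|x].
  by rewrite divr_ge0// adjop_norm_ge0.
by rewrite mulrAC ler_pdivlMr// mulrC -normrZ; exact: (le_opnorm (a *: T)).
Qed.

HB.instance Definition _ := Lmodule_isNormed.Build R[i] (adjop ip)
  adjop_normD adjop_normZ adjop_norm0.

Lemma le_normop T x : `|op T x| <= `|T| * `|x|.
Proof. exact: le_opnorm. Qed.

Lemma normop_le T (M : R[i]) :
  0 <= M -> (forall x, `|op T x| <= M * `|x|) -> `|T| <= M.
Proof. exact: opnorm_le. Qed.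

Lemma op_sub T U x : op (T - U) x = op T x - op U x.
Proof. by rewrite op_add op_opp. Qed.

Lemma adj_sub T U x : adj (T - U) x = adj T x - adj U x.
Proof. by rewrite adj_add adj_opp. Qed.

Lemma le_normadj T x : `|adj T x| <= `|T| * `|x|.
Proof. exact: le_opnorm_adj. Qed.

Lemma normop_star T : `|adjop_star T| = `|T|.
Proof.
by apply/eqP; rewrite eq_le; apply/andP; split; apply: normop_le => // x;
  [exact: le_normadj | exact: (le_normadj (adjop_star T))].
Qed.

Lemma normop_comp T U : `|adjop_comp T U| <= `|T| * `|U|.
Proof.
apply: normop_le => [|x]; first exact: mulr_ge0.
by rewrite -mulrA; apply: le_trans (le_normop T (op U x)) _; rewrite ler_wpM2l// le_normop.
Qed.

(** The C*-identity. For the lower bound, [|T x|^2 = ip x (T^* T x) <= |T^* T| |x|^2], so the square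
    root of [|T^* T|] is a bound of [T]. *)
Lemma normop_star_comp T : `|adjop_comp (adjop_star T) T| = `|T| ^+ 2.
Proof.
apply/eqP; rewrite eq_le; apply/andP; split.
  by apply: le_trans (normop_comp _ _) _; rewrite normop_star.
rewrite -[leRHS]sqr_sqrtc ler_pXn2r ?nnegrE ?sqrtc_ge0//.
apply: normop_le => [|x]; first by rewrite sqrtc_ge0.
rewrite -(@ler_pXn2r _ 2) ?nnegrE ?mulr_ge0 ?sqrtc_ge0// exprMn sqr_sqrtc.
rewrite -(ip_norm ip) adjP -[leLHS]ger0_norm; last by rewrite -adjP ip_norm exprn_ge0.
apply: le_trans (cauchy_schwarz _ _ _) _.
by rewrite mulrC expr2 mulrA ler_wpM2r//; exact: (le_normop (adjop_comp (adjop_star T) T)).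
Qed.

End adjop_theory.

Section adjop_complete.
Context (R : realType) (H : completeNormedModType R[i]) (ip : inner_product H).

(* The limit is taken pointwise, simultaneously for operators and adjoints, so
   that no Riesz representation is needed. *)
Lemma adjop_cauchy_cvg (F : set_system (adjop ip)) :
  ProperFilter F -> cauchy F -> cvg F.
Proof.
move=> FF /cauchyP Fc.
(* The rate is linear in [|x|], with a constant independent of [x]; this one estimate later yields
   the adjoint relation, the boundedness of the limit and the convergence in norm. An abstract [g]
   covers [op] and [adj] at once. *)
have pointwise (g : adjop ip -> H -> H) :
    (forall T U x, `|g T x - g U x| <= `|T - U| * `|x|) ->
    exists l : H -> H, forall e : R[i], 0 < e -> forall T0 : adjop ip,
      F (ball T0 e) -> forall x, `|l x - g T0 x| <= e * `|x|.
  move=> gL.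
  have gc x : cvg ((fun T => g T x) @ F).
    apply: cauchy_cvg; apply/cauchyP => e e0.
    (* The added 1 keeps the denominator positive when [x = 0]; it plays the same part in the
       constant [c] below, whose doubled product accounts for one error on each side of the inner
       product. *)
    have e1 : 0 < e / (`|x| + 1) by rewrite divr_gt0// ltr_wpDl.
    have [T0 FT0] := Fc _ e1; exists (g T0 x).
    suff sub : ball T0 (e / (`|x| + 1)) `<=` (g ^~ x) @^-1` ball (g T0 x) e.
      exact: filterS sub FT0.
    move=> T; rewrite /preimage -!ball_normE /= => T0T.
    apply: le_lt_trans (gL _ _ _) _.
    move: T0T; rewrite ltr_pdivlMr ?ltr_wpDl//. apply: le_lt_trans.
    by rewrite ler_wpM2l// lerDl.
  exists (fun x => lim ((fun T => g T x) @ F)) => e e0 T0 FT0 x.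
  apply/ler_addgt0Pr => e' e'0.
  have /cvgrPdist_lt /(_ _ e'0) Fl := gc x.
  have [T [T0T lT]] := filter_ex (filterI FT0 Fl).
  rewrite -(subrKA (g T x)) addrC; apply: le_trans (ler_normD _ _) _.
  apply: lerD; last exact: ltW.
  apply: le_trans (gL _ _ _) _; rewrite ler_wpM2r// distrC; apply: ltW.
  by move: T0T; rewrite -ball_normE.
have [l hl] := pointwise (@op _ _ ip) (fun T U x =>
   eq_ind _ (fun z => `|z| <= _) (le_normop (T - U) x) _ (op_sub T U x)).
have [l' hl'] := pointwise (@adj _ _ ip) (fun T U x =>
   eq_ind _ (fun z => `|z| <= _) (le_normadj (T - U) x) _ (adj_sub T U x)).
have ll' x y : ip (l x) y = ip x (l' y).
  apply/eqP; rewrite -subr_eq0 -normr_le0; apply/ler_addgt0Pr => e e0.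
  rewrite add0r; set c := `|x| * `|y| *+ 2 + 1.
  have c0 : 0 < c by rewrite ltr_wpDl// mulrn_wge0// mulr_ge0.
  have e1 : 0 < e / c by rewrite divr_gt0.
  have [T FT] := Fc _ e1.
  have -> : ip (l x) y - ip x (l' y) = ip (l x - op T x) y - ip x (l' y - adj T y).
    by rewrite ipBl ipBr adjP opprB addrA subrK.
  apply: le_trans (ler_normB _ _) _.
  have -> : e = (e / c * (`|x| * `|y|)) + (e / c * (`|x| * `|y|)) + e / c.
    rewrite -[in RHS]mulr2n -mulrnAr -[X in _ + X]mulr1 -mulrDr divfK//.
    by rewrite gt_eqF.
  apply: ler_wpDr; [exact: ltW|apply: lerD].
    apply: le_trans (cauchy_schwarz _ _ _) _.
    by rewrite mulrA ler_wpM2r// hl.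
  apply: le_trans (cauchy_schwarz _ _ _) _.
  by rewrite mulrCA ler_wpM2l// hl'.
have [T0 FT0] := Fc _ ltr01.
have lb : exists M : R, forall x, `|l x| <= M%:C%C * `|x|.
  exists (1 + opnorm T0) => x; rewrite rmorphD mulrDl.
  rewrite -[l x](subrK (op T0 x)); apply: le_trans (ler_normD _ _) _.
  by apply: lerD; [exact: hl | exact: le_opnorm].
apply/cvg_ex; exists (AdjOp ll' lb); apply/cvgrPdist_le => e e0.
have e2 : 0 < e / 2 by rewrite divr_gt0.
have [T FT] := Fc _ e2; apply: filterS (FT) => U TU.
rewrite -(subrKA T) [e]splitr; apply: le_trans (ler_normD _ _) _.
apply: lerD; last by move: TU; rewrite -ball_normE => /ltW.
by apply: normop_le => [|x]; [exact: ltW | rewrite op_sub; exact: hl].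
Qed.

HB.instance Definition _ :=
  Uniform_isComplete.Build (adjop ip) adjop_cauchy_cvg.

Fact adjop_compA : associative (@adjop_comp _ _ ip).
Proof. by move=> T U V; exact: adjop_ext. Qed.
Fact adjop_compDl : left_distributive (@adjop_comp _ _ ip) +%R.
Proof. by move=> T U V; exact: adjop_ext. Qed.
Fact adjop_compDr : right_distributive (@adjop_comp _ _ ip) +%R.
Proof. by move=> T U V; apply: adjop_ext => x; exact: opD. Qed.
Fact adjop_compZl (c : R[i]) (T U : adjop ip) :
  adjop_comp (c *: T) U = c *: adjop_comp T U.
Proof. exact: adjop_ext. Qed.
Fact adjop_compZr (c : R[i]) (T U : adjop ip) :
  adjop_comp T (c *: U) = c *: adjop_comp T U.
Proof. by apply: adjop_ext => x; exact: opZ. Qed.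
Fact adjop_starK : involutive (@adjop_star _ _ ip).
Proof. by move=> T; exact: adjop_ext. Qed.
Fact adjop_starD : {morph @adjop_star _ _ ip : T U / T + U}.
Proof. by move=> T U; exact: adjop_ext. Qed.
Fact adjop_starZ (c : R[i]) (T : adjop ip) :
  adjop_star (c *: T) = c^*%C *: adjop_star T.
Proof. exact: adjop_ext. Qed.
Fact adjop_starM (T U : adjop ip) :
  adjop_star (adjop_comp T U) = adjop_comp (adjop_star U) (adjop_star T).
Proof. exact: adjop_ext. Qed.

HB.instance Definition _ := CompleteNormedModule_isCStarAlgebra.Build R (adjop ip)
  adjop_compA adjop_compDl adjop_compDr adjop_compZl adjop_compZr adjop_starK
  adjop_starD adjop_starZ adjop_starM (@normop_comp _ _ ip) (@normop_star_comp _ _ ip).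

End adjop_complete.

(** * The Hilbert space L^2 *)

Lemma normc_geRe (R : realType) (z : R[i]) : `|complex.Re z| <= normc z.
Proof. by case: z => a b /=; rewrite -sqrtr_sqr ler_wsqrtr// lerDl sqr_ge0. Qed.

Lemma normc_geIm (R : realType) (z : R[i]) : `|complex.Im z| <= normc z.
Proof. by case: z => a b /=; rewrite -sqrtr_sqr ler_wsqrtr// lerDr sqr_ge0. Qed.

Lemma normc_sqr (R : realType) (z : R[i]) :
  normc z ^+ 2 = complex.Re z ^+ 2 + complex.Im z ^+ 2.
Proof. by case: z => a b /=; rewrite sqr_sqrtr ?addr_ge0 ?sqr_ge0. Qed.

Section complex_integral.
Context (R : realType) (d : measure_display) (X : measurableType d).
Variable mu : {measure set X -> \bar R}.
Implicit Types h k : X -> R[i].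

(** The expression inside [dot] for an arbitrary integrand, so that sesquilinearity reduces to
    linearity of the integral. *)
Definition cintegral h : R[i] :=
  ((\int[mu]_x complex.Re (h x))%R +i* (\int[mu]_x complex.Im (h x))%R)%C.

Definition cintegrable h : Prop :=
  mu.-integrable setT (EFin \o (fun x => complex.Re (h x))) /\
  mu.-integrable setT (EFin \o (fun x => complex.Im (h x))).

Lemma cintegralD h k : cintegrable h -> cintegrable k ->
  cintegral (h + k) = cintegral h + cintegral k.
Proof.
move=> [h1 h2] [k1 k2]; rewrite -[RHS]/(_ +i* _)%C -!RintegralD//.
by congr (_ +i* _)%C; apply: eq_Rintegral => x _; rewrite fctE; case: (h x); case: (k x).
Qed.

Lemma cintegralZ (a : R[i]) h : cintegrable h -> cintegral (a *: h) = a * cintegral h.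
Proof.
case: a => a b [h1 h2].
have int c (f : X -> R) : mu.-integrable setT (EFin \o f) ->
    mu.-integrable setT (EFin \o (fun x => c * f x)).
  by move=> fi; exact: (integrableZl measurableT c fi).
rewrite -[RHS]/(_ +i* _)%C -!RintegralZl// -RintegralB ?int// -RintegralD ?int//.
by congr (_ +i* _)%C; apply: eq_Rintegral => x _; rewrite fctE; case: (h x).
Qed.

Lemma cintegral_conj h : cintegrable h ->
  cintegral (fun x => (h x)^*%C) = (cintegral h)^*%C.
Proof.
move=> [h1 h2]; rewrite -[RHS]/(_ +i* (- _))%C.
rewrite -mulN1r -RintegralZl//.
by congr (_ +i* _)%C; apply: eq_Rintegral => x _; case: (h x) => //= a b; rewrite mulN1r.
Qed.

Lemma ae_eq_cintegral h k : cmeasurable h -> cmeasurable k ->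
  {ae mu, forall x, h x = k x} -> cintegral h = cintegral k.
Proof.
move=> [mh1 mh2] [mk1 mk2] hk.
have mE (c : X -> R) : measurable_fun setT c -> measurable_fun setT (EFin \o c).
  by move=> mc; apply/measurable_EFinP.
by congr (fine _ +i* fine _)%C; apply: ae_eq_integral => //;
  first [exact: mE | apply: filterS hk => x -> _].
Qed.

Lemma cmeasurableM h k : cmeasurable h -> cmeasurable k ->
  cmeasurable (fun x => h x * k x).
Proof.
move=> [h1 h2] [k1 k2]; split.
- rewrite (_ : (fun x => _) = (fun x =>
    complex.Re (h x) * complex.Re (k x) - complex.Im (h x) * complex.Im (k x))).
    by apply: measurable_funB; exact: measurable_funM.
  by apply/funext => x; case: (h x); case: (k x).
- rewrite (_ : (fun x => _) = (fun x =>
    complex.Re (h x) * complex.Im (k x) + complex.Im (h x) * complex.Re (k x))).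
    by apply: measurable_funD; exact: measurable_funM.
  by apply/funext => x; case: (h x); case: (k x).
Qed.

Lemma cmeasurable_conj h : cmeasurable h -> cmeasurable (fun x => (h x)^*%C).
Proof.
move=> [h1 h2]; split.
- by rewrite (_ : (fun x => _) = (fun x => complex.Re (h x)))//; apply/funext => x; case: (h x).
- rewrite (_ : (fun x => _) = (fun x => - complex.Im (h x)));
    last by apply/funext => x; case: (h x).
  exact: measurable_funN.
Qed.

Lemma cmeasurableB h k : cmeasurable h -> cmeasurable k -> cmeasurable (h - k).
Proof. by move=> mh mk; rewrite addrC -scaleN1r; exact: cmeasurable_lin. Qed.

Lemma cmeasurable_indic (A : set X) : measurable A ->
  cmeasurable (fun x => (\1_A x : R)%:C%C).
Proof. by move=> mA; split; [exact: measurable_indic | exact: measurable_cst]. Qed.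

End complex_integral.

Section L2_inner_product.
Context (R : realType) (d : measure_display) (X : measurableType d).
Variable mu : {measure set X -> \bar R}.
Implicit Types f g : L2fun mu.

Lemma L2fun_measurable_sqr f : measurable_fun setT (fun x => (normc (f x) ^+ 2)%:E).
Proof.
apply/measurable_EFinP/measurable_funX/measurable_normc; exact: L2fun_cmeas.
Qed.

Lemma sq_integrableE (f : X -> R[i]) : cmeasurable f ->
  (f \in sq_integrable mu) = (\int[mu]_x (normc (f x) ^+ 2)%:E < +oo)%E.
Proof.
move=> mf; apply/asboolP/idP; rewrite /finite_norm (Lnorm2E mu f).
  by move=> [_]; apply: lty_poweRy; rewrite invr_eq0 pnatr_eq0.
by move=> fi; split=> //; exact: poweR_lty.
Qed.

Lemma L2fun_sqr_lty f : (\int[mu]_x (normc (f x) ^+ 2)%:E < +oo)%E.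
Proof. by rewrite -sq_integrableE; [case: f | exact: L2fun_cmeas]. Qed.

Lemma L2fun_sqr_ge0 f : (0 <= \int[mu]_x (normc (f x) ^+ 2)%:E)%E.
Proof. by apply: integral_ge0 => x _; rewrite lee_fin sqr_ge0. Qed.

Lemma L2fun_sqr_integrable f : mu.-integrable setT (EFin \o (fun x => normc (f x) ^+ 2)).
Proof.
apply/integrableP; split; first exact: L2fun_measurable_sqr.
rewrite (eq_integral (fun x => (normc (f x) ^+ 2)%:E)) ?L2fun_sqr_lty// => x _.
by rewrite /= ger0_norm ?sqr_ge0.
Qed.

Lemma L2norm_sqr f :
  `|L2class f| ^+ 2 = (fine (\int[mu]_x (normc (f x) ^+ 2)%:E))%:C%C.
Proof.
rewrite [X in X ^+ 2 = _]L2norm_class (Lnorm2E mu f) fine_poweR -rmorphXn /=; congr (_%:C)%C.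
by rewrite -powR_mulrn ?powR_ge0// -powRrM mulVf ?pnatr_eq0// powRr1// fine_ge0// L2fun_sqr_ge0.
Qed.

(** Both parts of the product are dominated by [|f| |g| <= |f|^2 + |g|^2]. *)
Lemma dot_integrable f g : cintegrable mu (fun x => f x * (g x)^*%C).
Proof.
have mfg : cmeasurable (fun x => f x * (g x)^*%C).
  by apply: cmeasurableM; [|apply: cmeasurable_conj]; exact: L2fun_cmeas.
have dom (c : R[i] -> R) : (forall z, `|c z| <= normc z) ->
    measurable_fun setT (fun x => c (f x * (g x)^*%C)) ->
    mu.-integrable setT (EFin \o (fun x => c (f x * (g x)^*%C))).
  move=> cn mc.
  apply: (@le_integrable _ _ _ _ _ measurableT _
    (EFin \o (fun x => normc (f x) ^+ 2 + normc (g x) ^+ 2))).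
  - exact/measurable_EFinP.
  - move=> x _ /=; rewrite lee_fin (le_trans (cn _))// ComplexField.Normc.normcM.
    have -> : normc (g x)^*%C = normc (g x) by case: (g x) => a b /=; rewrite sqrrN.
    rewrite [leRHS]ger0_norm; last by rewrite addr_ge0// sqr_ge0.
    have := sqr_ge0 (normc (f x) - normc (g x)).
    have := normc_ge0 (f x); have := normc_ge0 (g x); nra.
  - exact: (integrableD measurableT (L2fun_sqr_integrable f) (L2fun_sqr_integrable g)).
by split; apply: dom; [exact: normc_geRe | case: mfg | exact: normc_geIm | case: mfg].
Qed.

(** [dot] is defined through chosen representatives; any others differ from them on a null set
    only. *)
Lemma dot_class f g :
  dot (L2class f) (L2class g) = cintegral mu (fun x => f x * (g x)^*%C).
Proof.
apply: ae_eq_cintegral.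
- by apply: cmeasurableM; [|apply: cmeasurable_conj]; exact: L2fun_cmeas.
- by apply: cmeasurableM; [|apply: cmeasurable_conj]; exact: L2fun_cmeas.
- by apply: filterS2 (L2class_repr f) (L2class_repr g) => x -> ->.
Qed.

Fact dotDl (u v w : L2 mu) : dot (u + v) w = dot u w + dot v w.
Proof.
rewrite -[u]L2reprK -[v]L2reprK -[w]L2reprK -L2classD !dot_class.
rewrite -cintegralD; [|exact: dot_integrable..].
by congr cintegral; apply/funext => x; exact: mulrDl.
Qed.

Fact dotZl (a : R[i]) (u v : L2 mu) : dot (a *: u) v = a * dot u v.
Proof.
rewrite -[u]L2reprK -[v]L2reprK -[_ *: _]L2classZ !dot_class.
rewrite -cintegralZ; last exact: dot_integrable.
by congr cintegral; apply/funext => x; exact: esym (mulrA _ _ _).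
Qed.

Fact dotC (u v : L2 mu) : dot v u = (dot u v)^*%C.
Proof.
rewrite -[u]L2reprK -[v]L2reprK !dot_class -cintegral_conj; last exact: dot_integrable.
by congr cintegral; apply/funext => x; rewrite rmorphM /= conjcK mulrC.
Qed.

Fact dot_norm (u : L2 mu) : dot u u = `|u| ^+ 2.
Proof.
rewrite -[u]L2reprK dot_class L2norm_sqr; congr (_ +i* _)%C.
  congr fine; apply: eq_integral => x _; congr EFin; case: (L2repr u x) => a b /=.
  by rewrite sqr_sqrtr ?addr_ge0 ?sqr_ge0// mulrN opprK !expr2.
rewrite (@eq_Rintegral _ _ _ mu setT (cst 0)) ?Rintegral_cst ?mul0r// => x _.
by case: (L2repr u x) => a b /=; rewrite mulrN mulrC addNr.
Qed.

Definition L2_ip : inner_product (L2 mu) := InnerProduct dotDl dotZl dotC dot_norm.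

End L2_inner_product.

(** * Completeness of L^2 (Riesz-Fischer) *)

Lemma cvg_geometric_diff (R : realType) (v : nat -> R) (K : R) :
  0 <= K -> (forall n, `|v n.+1 - v n| <= K * 2^-1 ^+ n) -> cvgn v.
Proof.
move=> K0 vK.
(* A sequence is its first term plus the series of its increments, here absolutely convergent by
   comparison with a geometric series. *)
have -> : v = (fun n => v 0 + series (telescope v) n).
  by apply/funext => n; exact: eq_sum_telescope.
apply: is_cvgD; first exact: is_cvg_cst.
apply: normed_cvg.
apply: (@series_le_cvg _ (fun n => `|telescope v n|) (geometric K 2^-1)) => //.
- by move=> n /=; rewrite mulr_ge0// exprn_ge0.
- apply: is_cvg_geometric_series.
  by rewrite ger0_norm// invf_lt1// ltr1n.
Qed.

Section L2_complete.
Context (R : realType) (d : measure_display) (X : measurableType d).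
Variable mu : {measure set X -> \bar R}.

Lemma L2class_norm_le (f : L2fun mu) (K : R) : 0 <= K ->
  (`|L2class f| <= K%:C%C) = (\int[mu]_x (normc (f x) ^+ 2)%:E <= (K ^+ 2)%:E)%E.
Proof.
move=> K0; have K0' : 0 <= K%:C%C by rewrite ler0c.
rewrite -(@ler_pXn2r _ 2) ?nnegrE// L2norm_sqr -rmorphXn lecR.
by rewrite -lee_fin fineK// ge0_fin_numE ?L2fun_sqr_lty// L2fun_sqr_ge0.
Qed.

Section fast_cauchy.
Variable f : nat -> L2fun mu.
(** Two points at distance less than [4^-n] and [4^-m] from a common point, with [n <= m], are
    within [2 * 4^-n] of each other. *)
Let e n : R := 2 * 4^-1 ^+ n.
Hypothesis f_cauchy : forall n m, (n <= m)%N -> `|L2class (f m - f n)| <= (e n)%:C%C.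

Let e0 n : 0 <= e n. Proof. by rewrite mulr_ge0// exprn_ge0. Qed.

(** The weight [4^n] balances two needs: the integrals, at most [4^n (2 * 4^-n)^2 = 4 * 4^-n],
    remain summable, and finiteness of the sum [G] at a point bounds the increments there by
    [sqrt G * 2^-n]. *)
Let a n x : \bar R := (4 ^+ n * normc ((f n.+1 - f n) x) ^+ 2)%:E.
Let a0 n x : (0 <= a n x)%E.
Proof. by rewrite lee_fin mulr_ge0 ?sqr_ge0 ?exprn_ge0. Qed.
Let ma n : measurable_fun setT (a n).
Proof.
apply/measurable_EFinP; apply: measurable_funM => //.
by apply: measurable_funX; apply: measurable_normc; exact: L2fun_cmeas.
Qed.

Let G x : \bar R := (\sum_(n <oo) a n x)%E.

Let mG : measurable_fun setT G.
Proof. by apply: (@ge0_emeasurable_sum _ _ _ _ _ predT) => // n x _ _; exact: a0. Qed.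

Let G_ge0 x : (0 <= G x)%E.
Proof. by apply: nneseries_ge0 => n _ _; exact: a0. Qed.

Let G_integrable : mu.-integrable setT G.
Proof.
apply/integrableP; split=> //.
under eq_integral do rewrite gee0_abs//.
rewrite integral_nneseries//.
have h n : (\int[mu]_x a n x <= (4 * 4^-1 ^+ n)%:E)%E.
  have -> : (\int[mu]_x a n x = (4 ^+ n)%:E * \int[mu]_x (normc ((f n.+1 - f n)%R x) ^+ 2)%:E)%E.
    rewrite -ge0_integralZl_EFin ?exprn_ge0//.
      by move=> x _; rewrite lee_fin sqr_ge0.
    exact: L2fun_measurable_sqr.
  have -> : 4 * 4^-1 ^+ n = 4 ^+ n * e n ^+ 2.
    by rewrite /e exprVn; field; rewrite expf_neq0.
  rewrite EFinM lee_wpmul2l ?lee_fin ?exprn_ge0//.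
  by rewrite -L2class_norm_le//; exact: f_cauchy.
(* [epsilon_trick0] bounds a sum of terms [8 / 2^(n+1) = 4 * 2^-n], which dominate [4 * 4^-n]. *)
have : (\sum_(n <oo) \int[mu]_x a n x <= 8%:E)%E.
  apply: le_trans (epsilon_trick0 predT _) => //; apply: lee_nneseries => n _ //.
    by move=> _; apply: integral_ge0 => x _; exact: a0.
  apply: le_trans (h n) _; rewrite lee_fin.
  have -> : 8 / (2 ^ n.+1)%:R = 4 * 2^-1 ^+ n :> R.
    by rewrite natrX exprS exprVn; field; rewrite expf_neq0.
  by rewrite ler_wpM2l// lerXn2r ?nnegrE// lef_pV2 ?posrE// ler_nat.
by move/le_lt_trans; apply; exact: ltry.
Qed.

Let A := [set x | (G x < +oo)%E].
Let mA : measurable A.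
Proof. by rewrite /A -[X in measurable X]setTI; exact: emeasurable_fun_infty_o. Qed.

Let ae_A : {ae mu, forall x, A x}.
Proof.
apply: filterS (integrable_ae measurableT G_integrable) => x /(_ I).
by rewrite /A /= ge0_fin_numE.
Qed.

Let normc_le x n : A x -> normc (f n.+1 x - f n x) <= Num.sqrt (fine (G x)) * 2^-1 ^+ n.
Proof.
move=> Ax; have Gx : G x \is a fin_num by rewrite ge0_fin_numE.
have : (a n x <= G x)%E.
  rewrite /G (nneseriesD1 (n := n)) => [|k _|//]; last exact: a0.
  by rewrite leeDl// nneseries_ge0.
rewrite -(fineK Gx) lee_fin => h.
have h0 : 0 <= 2 ^+ n * normc (f n.+1 x - f n x) by rewrite mulr_ge0 ?exprn_ge0 ?normc_ge0.
rewrite exprVn ler_pdivlMr ?exprn_gt0// mulrC -[leLHS]ger0_norm// -sqrtr_sqr.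
apply: ler_wsqrtr; apply: le_trans h.
by rewrite exprMn -exprM mulnC exprM (_ : 2 ^+ 2 = 4) //; ring.
Qed.

(** Cut off outside the conull set [A], the sequence converges at every point, so its limit is
    measurable as an everywhere pointwise limit. *)
Let g n x : R[i] := (\1_A x)%:C%C * f n x.

Let g_ae n : {ae mu, forall x, g n x = f n x}.
Proof.
by apply: filterS ae_A => x Ax; rewrite /g indicE mem_set// rmorph1 mul1r.
Qed.

Let mg n : cmeasurable (g n).
Proof. by apply: cmeasurableM; [exact: cmeasurable_indic | exact: L2fun_cmeas]. Qed.

Let g_cvg (c : R[i] -> R) x : c 0 = 0 -> (forall z w, c (z - w) = c z - c w) ->
  (forall z, `|c z| <= normc z) -> cvgn (fun n => c (g n x)).
Proof.
move=> c0 cB cn; rewrite /g indicE; case: (boolP (x \in A)) => [/set_mem Ax|_] /=.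
  under eq_fun do rewrite rmorph1 mul1r.
  apply: (@cvg_geometric_diff _ _ (Num.sqrt (fine (G x)))) => // n.
  by rewrite -cB; exact: le_trans (cn _) (normc_le n Ax).
under eq_fun do rewrite rmorph0 mul0r c0.
exact: is_cvg_cst.
Qed.

Let l x : R[i] :=
  (limn (fun n => complex.Re (g n x)) +i* limn (fun n => complex.Im (g n x)))%C.

Let g_cvgRe x : complex.Re (g n x) @[n --> \oo] --> complex.Re (l x).
Proof. by apply: (@g_cvg (@complex.Re R)) => // [[? ?] [? ?]//|z]; exact: normc_geRe. Qed.

Let g_cvgIm x : complex.Im (g n x) @[n --> \oo] --> complex.Im (l x).
Proof. by apply: (@g_cvg (@complex.Im R)) => // [[? ?] [? ?]//|z]; exact: normc_geIm. Qed.

Let ml : cmeasurable l.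
Proof.
split.
- apply: (@measurable_fun_cvg _ _ _ _ (fun n x => complex.Re (g n x))) => [n|x _].
    by case: (mg n).
  exact: g_cvgRe.
- apply: (@measurable_fun_cvg _ _ _ _ (fun n x => complex.Im (g n x))) => [n|x _].
    by case: (mg n).
  exact: g_cvgIm.
Qed.

(** Fatou's lemma for [|g (n + m) - g n|^2] as [m] grows: the limit is [|l - g n|^2], and every
    integral is at most [e n ^+ 2] by the Cauchy hypothesis. *)
Let l_dist n : (\int[mu]_x (normc (l x - f n x) ^+ 2)%:E <= (e n ^+ 2)%:E)%E.
Proof.
have mq (h k : X -> R[i]) : cmeasurable h -> cmeasurable k ->
    measurable_fun setT (EFin \o (fun x => normc (h x - k x) ^+ 2)).
  move=> mh mk; apply/measurable_EFinP; apply: measurable_funX.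
  by apply: (measurable_normc (f := h - k)); exact: cmeasurableB.
have -> : (\int[mu]_x (normc (l x - f n x) ^+ 2)%:E =
    \int[mu]_x (limn_einf (fun m => (normc (g (n + m)%N x - g n x) ^+ 2)%:E)))%E.
  have lE x : limn_einf (fun m => (normc (g (n + m)%N x - g n x) ^+ 2)%:E) =
      (normc (l x - g n x) ^+ 2)%:E.
    apply: (fst (cvg_limn_einf_sup _)); apply: cvg_EFin; first exact: nearW.
    have sqr_cvg (c : R[i] -> R) : (forall z w, c (z - w) = c z - c w) ->
        c (g m x) @[m --> \oo] --> c (l x) ->
        c (g (n + m)%N x - g n x) ^+ 2 @[m --> \oo] --> c (l x - g n x) ^+ 2.
      move=> cB cg; have {}cg : c (g (n + m)%N x) @[m --> \oo] --> c (l x).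
        by under eq_fun do rewrite addnC; rewrite -(cvg_shiftn n) in cg.
      under eq_fun do rewrite cB expr2; rewrite cB expr2.
      by apply: cvgM; apply: cvgB => //; exact: cvg_cst.
    rewrite /=; under eq_fun do rewrite normc_sqr.
    rewrite normc_sqr; apply: cvgD; apply: sqr_cvg => //; by case=> ? ? [? ?].
  under [RHS]eq_integral do rewrite lE.
  apply: ae_eq_integral => //.
  - by apply: mq => //; exact: L2fun_cmeas.
  - exact: mq.
  - by apply: filterS (g_ae n) => x -> _.
apply: le_trans (fatou _ _ _ _) _ => //.
- by move=> m; exact: mq.
- by move=> m x _; rewrite lee_fin sqr_ge0.
rewrite limn_einf_lim; apply: lime_le; first exact: is_cvg_einfs.
apply: nearW => m; apply: le_trans (ereal_inf_lbound _) _; first by exists m => /=.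
rewrite (ae_eq_integral (fun x => (normc ((f (n + m)%N - f n) x) ^+ 2)%:E)) //.
- by rewrite -L2class_norm_le// f_cauchy// leq_addr.
- exact: mq.
- exact: L2fun_measurable_sqr.
- by apply: filterS2 (g_ae n) (g_ae (n + m)) => x -> -> _.
Qed.

Lemma fast_cauchy_limit :
  exists u : L2fun mu, forall n, `|L2class (u - f n)| <= (e n)%:C%C.
Proof.
have lf n : l - f n \in sq_integrable mu.
  rewrite sq_integrableE; last by apply: cmeasurableB => //; exact: L2fun_cmeas.
  by apply: le_lt_trans (l_dist n) _; rewrite ltry.
have fL n : L2fun_val (f n) \in sq_integrable mu by case: (f n).
have lL : l \in sq_integrable mu
  by rewrite -[l](subrK (L2fun_val (f 0%N))); exact: rpredD (lf 0%N) (fL 0%N).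
exists (MkL2fun lL) => n; rewrite L2class_norm_le; last exact: e0.
exact: l_dist.
Qed.

End fast_cauchy.

(** The filter is replaced by centres [u n] of balls of radius [4^-n] belonging to it. Any two of
    these balls meet, which makes the centres a fast Cauchy sequence. *)
Lemma L2_cauchy_cvg (F : set_system (L2 mu)) :
  ProperFilter F -> cauchy F -> cvg F.
Proof.
move=> FF /cauchyP Fc.
pose e n : R := 4^-1 ^+ n.
have e_gt0 n : 0 < (e n)%:C%C by rewrite (ltcR 0) exprn_gt0.
have [u Fu] := choice (fun n => Fc _ (e_gt0 n)).
have [l ul] : exists l : L2fun mu, forall n, `|L2class (l - L2repr (u n))| <= (2 * e n)%:C%C.
  apply: fast_cauchy_limit => n m nm.
  have -> : L2class (L2repr (u m) - L2repr (u n)) = u m - u n.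
    by rewrite -[in RHS](L2reprK (u m)) -[in RHS](L2reprK (u n)) /L2class !piE.
  have [w []] := filter_ex (filterI (Fu n) (Fu m)).
  rewrite -!ball_normE /= => nw mw.
  rewrite -(subrKA w) mulr_natl mulr2n rmorphD /=.
  apply: le_trans (ler_normD _ _) _; apply: lerD; last by rewrite distrC (ltW nw).
  apply: le_trans (ltW mw) _; by rewrite lecR ler_wiXn2l// invf_le1// ler1n.
have {}ul n : `|L2class l - u n| <= (2 * e n)%:C%C.
  by rewrite -[u n]L2reprK; move: (ul n); rewrite /L2class !piE.
apply/cvg_ex; exists (L2class l); apply/cvgrPdist_lt => r r0.
have rE : (complex.Re r)%:C%C = r by rewrite RRe_real ?gtr0_real.
(* The factor 3 is 2 for the distance from the limit to [u n], plus 1 for the radius of the ball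
   around [u n]. *)
have [n en] : exists n, 3 * e n < complex.Re r.
  have re0 : 0 < complex.Re r by rewrite -ltcR rE.
  have h : `|4^-1 : R| < 1 by rewrite ger0_norm// invf_lt1// ltr1n.
  have /cvgrPdist_lt /(_ _ re0) := cvg_geometric 3 h.
  move=> [n _ /(_ n (leqnn n))]; rewrite /= sub0r normrN => hn; exists n.
  by apply: le_lt_trans hn; rewrite ler_norm.
have sub : ball (u n) (e n)%:C%C `<=` (fun t => `|L2class l - t| < r).
  move=> t; rewrite -ball_normE /= => ut; rewrite -(subrKA (u n)).
  apply: le_lt_trans (ler_normD _ _) _; apply: lt_le_trans (_ : _ < (2 * e n + e n)%:C%C) _.
    by rewrite rmorphD ler_ltD// ul.
  by rewrite -rE lecR; move/ltW: en; congr (_ <= _); ring.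
exact: filterS sub (Fu n).
Qed.

End L2_complete.
HB.instance Definition _ (R : realType) (d : measure_display) (X : measurableType d)
    (mu : {measure set X -> \bar R}) :=
  Uniform_isComplete.Build (L2 mu) (@L2_cauchy_cvg R d X mu).

(** * Change of variables along a branch *)

Section change_of_variables.
Context (R : realType) (d : measure_display) (X : measurableType d).
Variable mu : {measure set X -> \bar R}.

(** The conditions on a single map, with no mention of an inverse, so that what follows applies to
    [f_e] and to [f_e^{-1}] alike. Surjectivity is one inclusion up to a null set, the other being
    [branch_fun]. *)
Record branch (D Rg : set X) (f : X -> X) (Phi : X -> R) : Prop := Branch {
  branch_dom : measurable D;
  branch_rng : measurable Rg;
  branch_fun : set_fun D Rg f;
  branch_measurable : measurable_fun D f;
  branch_onto : mu (Rg `\` f @` D) = 0%E;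
  branch_RN : is_RN_derivative mu D f Phi }.

Context (D Rg : set X) (f : X -> X) (Phi : X -> R).
Hypothesis fb : branch D Rg f Phi.
Local Open Scope ereal_scope.

Lemma branch_density_ge0 x : 0 <= (Phi x)%:E.
Proof. by rewrite lee_fin; exact: RN_ge0 (branch_RN fb) x. Qed.

Lemma branch_density_measurable A : measurable_fun A (fun x => (Phi x)%:E).
Proof.
by apply: measurable_funTS; apply/measurable_EFinP; exact: RN_measurable (branch_RN fb).
Qed.

Lemma branch_preimage_measurable A : measurable A -> measurable (D `&` f @^-1` A).
Proof. by move=> mA; exact: branch_measurable fb (branch_dom fb) A mA. Qed.

(** The change of variables for a characteristic function: the integral is the measure of
    [f (D) & A], written for an intersection, which differs from [Rg & A] by a null set. *)
Lemma branch_integral_preimage A : measurable A ->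
  \int[mu]_(x in D `&` f @^-1` A) (Phi x)%:E = mu (Rg `&` A).
Proof.
move=> mA; have mB := branch_preimage_measurable mA.
have mfB := RN_image (branch_RN fb) mB (@subIsetl _ _ _).
have mfD := RN_image (branch_RN fb) (branch_dom fb) (@subset_refl _ _).
rewrite -(RN_integral (branch_RN fb) mB (@subIsetl _ _ _)).
have mRg := branch_rng fb.
rewrite [RHS](measureDI mu (B := f @` D))//; last exact: measurableI.
rewrite [X in _ = X + _](_ : _ = 0); last first.
  apply: (subset_measure0 _ _ _ (branch_onto fb)).
  - by apply: measurableD => //; exact: measurableI.
  - exact: measurableD.
  - by move=> x [[Rx _] fx].
rewrite add0e; congr (mu _); apply/seteqP; split=> [_ [x [Dx Ax] <-]|y [[Ry Ay] [x Dx fxy]]].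
  by split; [split=> //; exact: branch_fun fb _ Dx | exists x].
by exists x => //; split => //; rewrite /preimage /= fxy.
Qed.

Import HBNNSimple.

(** Monotone convergence on both sides reduces [h] to a simple function; expanding it over its
    values leaves its level sets, treated by [branch_integral_preimage]. *)
Lemma branch_change_of_variables (h : X -> \bar R) :
  measurable_fun setT h -> (forall x, 0 <= h x) ->
  \int[mu]_(x in D) ((Phi x)%:E * h (f x)) = \int[mu]_(x in Rg) h x.
Proof.
move=> mh h0; pose g := nnsfun_approx measurableT mh.
have mD := branch_dom fb; have mRg := branch_rng fb.
have hE x : EFin \o g^~ x @ \oo --> h x by exact: cvg_nnsfun_approx.
have ndg x : nondecreasing_seq (EFin \o g^~ x).
  by move=> m n mn; rewrite lee_fin; exact/lefP/nd_nnsfun_approx.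
have mgf (k : X -> \bar R) : measurable_fun setT k -> measurable_fun D (k \o f).
  by move=> mk; apply: measurable_comp mk (branch_measurable fb).
have -> : \int[mu]_(x in Rg) h x = limn (fun n => \int[mu]_(x in Rg) (g n x)%:E).
  under eq_integral do rewrite -(cvg_lim _ (hE _))//.
  apply: monotone_convergence => //.
  - move=> n; apply: measurable_funTS; exact/measurable_EFinP.
  - by move=> n x _; rewrite lee_fin.
  - by move=> x _; exact: ndg.
have -> : \int[mu]_(x in D) ((Phi x)%:E * h (f x)) =
    limn (fun n => \int[mu]_(x in D) ((Phi x)%:E * (g n (f x))%:E)).
  have hfE x : (Phi x)%:E * (g n (f x))%:E @[n --> \oo] --> (Phi x)%:E * h (f x).
    by apply: cvgeZl => //; exact: hE.
  under eq_integral do rewrite -(cvg_lim _ (hfE _))//.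
  apply: monotone_convergence => //.
  - move=> n; apply: emeasurable_funM; first exact: branch_density_measurable.
    by apply: (mgf (EFin \o g n)); exact/measurable_EFinP.
  - by move=> n x _; rewrite mule_ge0 ?branch_density_ge0// lee_fin.
  - by move=> x _ m n mn; rewrite lee_wpmul2l ?branch_density_ge0//; exact: ndg.
congr (lim (_ @ \oo)); apply/funext => n.
pose B r := g n @^-1` [set r].
have mB r : measurable (B r) by rewrite /B -[X in measurable X]setTI; exact: (measurable_funP (g n)).
have gE x : (g n x)%:E = \sum_(r \in range (g n)) (r%:E * (\1_(B r) x)%:E).
  by rewrite fimfunE -fsumEFin.
have gB0 r x : 0 <= r%:E * (\1_(B r) x)%:E by exact: nnfun_muleindic_ge0.
have m1 r : measurable_fun setT (fun x => (\1_(B r) x)%:E : \bar R).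
  by apply/measurable_EFinP; exact: measurable_indic.
have g0 r : r \in range (g n) -> (0 <= r)%R by rewrite inE => -[x _ <-].
transitivity (\sum_(r \in range (g n)) r%:E * mu (Rg `&` B r)); last first.
  under eq_integral do rewrite gE.
  rewrite ge0_integral_fsum//; last first.
    by move=> r; apply: measurable_funTS; apply: measurable_funeM.
  apply: eq_fsbigr => r rg.
  rewrite ge0_integralZl_EFin//; [|by apply: measurable_funTS|exact: g0].
  by rewrite integral_indic// setIC.
under eq_integral do rewrite gE ge0_mule_fsumr//.
rewrite ge0_integral_fsum//.
- apply: eq_fsbigr => r rg.
  under eq_integral do rewrite muleCA.
  rewrite ge0_integralZl_EFin//.
  + congr (_ * _); rewrite -branch_integral_preimage// integral_mkcondr.
    by apply: eq_integral => x _; rewrite epatch_indic.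
  + by move=> x _; rewrite mule_ge0 ?branch_density_ge0.
  + apply: emeasurable_funM; first exact: branch_density_measurable.
    exact: (mgf (fun x => (\1_(B r) x)%:E)).
  + exact: g0.
- move=> r; apply: emeasurable_funM; first exact: branch_density_measurable.
  by apply: (mgf (fun x => r%:E * (\1_(B r) x)%:E)); exact: measurable_funeM.
- by move=> r x _; rewrite mule_ge0 ?branch_density_ge0.
Qed.

End change_of_variables.

(** * Restriction and transfer operators *)

Section L2_lift.
Context (R : realType) (d : measure_display) (X : measurableType d).
Variable mu : {measure set X -> \bar R}.
Variable L : L2fun mu -> L2fun mu.
Hypothesis LB : forall f g, L (f - g) = L f - L g.
Hypothesis LN : forall f, `|L2class (L f)| <= `|L2class f|.

Lemma L2classB (f g : L2fun mu) : L2class (f - g) = L2class f - L2class g.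
Proof. by rewrite /L2class !piE. Qed.

Definition L2lift (u : L2 mu) : L2 mu := L2class (L u).

(** Independence of the representative follows from contractivity: [L] of a null difference has norm
    0. For composition operators this replaces an argument on preimages of null sets. *)
Lemma L2liftE f : L2lift (L2class f) = L2class (L f).
Proof.
apply/eqP; rewrite -subr_eq0 -normr_le0 /L2lift -L2classB -LB.
by apply: le_trans (LN _) _; rewrite L2classB L2reprK subrr normr0.
Qed.

Lemma L2lift_norm u : `|L2lift u| <= `|u|.
Proof. by rewrite -[u in leRHS]L2reprK; exact: LN. Qed.

End L2_lift.

Lemma measurable_sqrtr (R : realType) : measurable_fun setT (@Num.sqrt R).
Proof. by apply: continuous_measurable_fun; exact: sqrt_continuous. Qed.

Section transfer.
Context (R : realType) (d : measure_display) (X : measurableType d).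
Variable mu : {measure set X -> \bar R}.
Implicit Types phi : L2fun mu.

Lemma L2class_norm_mono (phi psi : L2fun mu) :
  (\int[mu]_x (normc (phi x) ^+ 2)%:E <= \int[mu]_x (normc (psi x) ^+ 2)%:E)%E ->
  `|L2class phi| <= `|L2class psi|.
Proof.
move=> h; rewrite -(@ler_pXn2r _ 2) ?nnegrE// !L2norm_sqr lecR.
by apply: fine_le => //; rewrite ge0_fin_numE ?L2fun_sqr_lty ?L2fun_sqr_ge0.
Qed.

Lemma L2class_norm_eq (phi psi : L2fun mu) :
  (\int[mu]_x (normc (phi x) ^+ 2)%:E = \int[mu]_x (normc (psi x) ^+ 2)%:E)%E ->
  `|L2class phi| = `|L2class psi|.
Proof. by move=> h; apply/eqP; rewrite eq_le !L2class_norm_mono ?h. Qed.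

Section restriction.
Variable A : set X.
Hypothesis mA : measurable A.

Lemma integral_indic_normc_sqr phi :
  (\int[mu]_x (normc ((\1_A x)%:C%C * phi x) ^+ 2)%:E =
   \int[mu]_(x in A) (normc (phi x) ^+ 2)%:E)%E.
Proof.
rewrite [RHS]integral_mkcond; apply: eq_integral => x _.
rewrite patchE indicE; case: (x \in A) => /=; first by rewrite rmorph1 mul1r.
by rewrite rmorph0 mul0r ComplexField.Normc.normc0 expr0n.
Qed.

Lemma integral_restrict_le phi :
  (\int[mu]_(x in A) (normc (phi x) ^+ 2)%:E <= \int[mu]_x (normc (phi x) ^+ 2)%:E)%E.
Proof.
apply: ge0_subset_integral => //; first exact: L2fun_measurable_sqr.
by move=> x _; rewrite lee_fin sqr_ge0.
Qed.

Lemma restrict_sq_integrable phi :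
  (fun x => (\1_A x)%:C%C * phi x) \in sq_integrable mu.
Proof.
rewrite sq_integrableE.
  rewrite integral_indic_normc_sqr; apply: le_lt_trans (L2fun_sqr_lty phi).
  exact: integral_restrict_le.
by apply: cmeasurableM; [exact: cmeasurable_indic | exact: L2fun_cmeas].
Qed.

Definition restrict_fun phi : L2fun mu := MkL2fun (restrict_sq_integrable phi).

Lemma restrict_funB phi psi :
  restrict_fun (phi - psi) = restrict_fun phi - restrict_fun psi.
Proof. by apply: val_inj; apply/funext => x; exact: mulrBr. Qed.

Lemma restrict_fun_norm phi : `|L2class (restrict_fun phi)| <= `|L2class phi|.
Proof.
by apply: L2class_norm_mono; rewrite integral_indic_normc_sqr; exact: integral_restrict_le.
Qed.

Definition restrict_op : L2 mu -> L2 mu := L2lift restrict_fun.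

Lemma restrict_opE phi : restrict_op (L2class phi) = L2class (restrict_fun phi).
Proof. exact: L2liftE restrict_funB restrict_fun_norm phi. Qed.

Lemma restrict_op_adj (u v : L2 mu) :
  L2_ip mu (restrict_op u) v = L2_ip mu u (restrict_op v).
Proof.
rewrite -[u]L2reprK -[v]L2reprK !restrict_opE /= !dot_class; congr cintegral.
apply/funext => x; rewrite /= !indicE; case: (x \in A) => /=; first by rewrite rmorph1 !mul1r.
by rewrite rmorph0 !mul0r conjc0 mulr0.
Qed.

Lemma restrict_op_bounded :
  exists M : R, forall u : L2 mu, `|restrict_op u| <= M%:C%C * `|u|.
Proof.
by exists 1 => u; rewrite mul1r; exact: L2lift_norm restrict_fun_norm u.
Qed.

Definition restriction : adjop (L2_ip mu) := AdjOp restrict_op_adj restrict_op_bounded.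

End restriction.

Section transfer_operator.
Context (D Rg : set X) (f : X -> X) (Phi : X -> R).
Hypothesis fb : branch mu D Rg f Phi.

Definition transfer_val (phi : X -> R[i]) (x : X) : R[i] :=
  if x \in D then (Num.sqrt (Phi x))%:C%C * phi (f x) else 0.

Lemma cmeasurable_transfer phi : cmeasurable (transfer_val phi).
Proof.
have [m1 m2] := L2fun_cmeas phi.
have h (c : R[i] -> R) : c 0 = 0 -> (forall (r : R) z, c (r%:C%C * z) = r * c z) ->
    measurable_fun setT (fun x => c (phi x)) ->
    measurable_fun setT (fun x => c (transfer_val phi x)).
  move=> c0 cZ mc.
  have -> : (fun x => c (transfer_val phi x)) =
      (fun x => Num.sqrt (Phi x) * c (phi (f x))) \_ D.
    apply/funext => x; rewrite patchE /transfer_val.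
    by case: ifP => _; rewrite ?cZ ?c0.
  apply/(measurable_restrictT _ (branch_dom fb)).1; apply: measurable_funM.
    apply: measurable_funTS; apply: measurableT_comp; first exact: measurable_sqrtr.
    exact: RN_measurable (branch_RN fb).
  exact: measurable_comp mc (branch_measurable fb).
split; apply: h => //.
- by move=> r [a b] /=; rewrite mul0r subr0.
- by move=> r [a b] /=; rewrite mul0r addr0.
Qed.

(** The weight squares to the density [Phi], so this is the change of variables formula for
    [|phi|^2]. *)
Lemma integral_transfer phi :
  (\int[mu]_x (normc (transfer_val phi x) ^+ 2)%:E =
   \int[mu]_(x in Rg) (normc (phi x) ^+ 2)%:E)%E.
Proof.
rewrite -(branch_change_of_variables fb) //.
- rewrite [RHS]integral_mkcond; apply: eq_integral => x _.
  rewrite patchE /transfer_val; case: ifP => _.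
    rewrite ComplexField.Normc.normcM exprMn -EFinM; congr (_ * _)%:E.
    by rewrite normc_sqr /= expr0n addr0 sqr_sqrtr// (RN_ge0 (branch_RN fb)).
  by rewrite ComplexField.Normc.normc0 expr0n.
- exact: L2fun_measurable_sqr.
- by move=> x; rewrite lee_fin sqr_ge0.
Qed.

Lemma transfer_sq_integrable phi : transfer_val phi \in sq_integrable mu.
Proof.
rewrite sq_integrableE; last exact: cmeasurable_transfer.
rewrite integral_transfer; apply: le_lt_trans (L2fun_sqr_lty phi).
exact: integral_restrict_le (branch_rng fb) phi.
Qed.

Definition transfer_fun phi : L2fun mu := MkL2fun (transfer_sq_integrable phi).

Lemma transfer_funB phi psi :
  transfer_fun (phi - psi) = transfer_fun phi - transfer_fun psi.
Proof.
apply: val_inj; apply/funext => x.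
rewrite [RHS]/(transfer_val phi x - transfer_val psi x) /= /transfer_val.
by case: ifP => _; [exact: mulrBr | exact: esym (subr0 _)].
Qed.

Lemma transfer_fun_norm phi : `|L2class (transfer_fun phi)| <= `|L2class phi|.
Proof.
apply: L2class_norm_mono; rewrite integral_transfer.
exact: integral_restrict_le (branch_rng fb) phi.
Qed.

Definition transfer : L2 mu -> L2 mu := L2lift transfer_fun.

Lemma transferE phi : transfer (L2class phi) = L2class (transfer_fun phi).
Proof. exact: L2liftE transfer_funB transfer_fun_norm phi. Qed.

Lemma transfer_bounded :
  exists M : R, forall u : L2 mu, `|transfer u| <= M%:C%C * `|u|.
Proof.
by exists 1 => u; rewrite mul1r; exact: L2lift_norm transfer_fun_norm u.
Qed.

Lemma transfer_isometry (u : L2 mu) : `|transfer u| = `|restrict_op (branch_rng fb) u|.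
Proof.
rewrite -[u]L2reprK transferE restrict_opE; apply: L2class_norm_eq.
by rewrite integral_transfer integral_indic_normc_sqr.
Qed.

Lemma transferD (u v : L2 mu) : transfer (u + v) = transfer u + transfer v.
Proof.
rewrite -[u]L2reprK -[v]L2reprK -L2classD !transferE -L2classD; congr L2class.
apply: val_inj; apply/funext => x.
rewrite [RHS]/(transfer_val (L2repr u) x + transfer_val (L2repr v) x) /= /transfer_val.
by case: ifP => _; [exact: mulrDr | exact: esym (addr0 _)].
Qed.

Lemma transferZ (a : R[i]) (u : L2 mu) : transfer (a *: u) = a *: transfer u.
Proof.
have ZE (h : L2fun mu) : a *: L2class h = L2class (a *: h) by rewrite L2classZ.
rewrite -[u]L2reprK ZE !transferE ZE; congr L2class.
apply: val_inj; apply/funext => x.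
rewrite [RHS]/(a * transfer_val (L2repr u) x) /= /transfer_val.
by case: ifP => _; [exact: mulrCA | exact: esym (mulr0 _)].
Qed.

End transfer_operator.
End transfer.

(** * Composites and adjoints of transfer operators along mutually inverse branches *)

Section inverse_branches.
Context (R : realType) (d : measure_display) (X : measurableType d).
Variable mu : {measure set X -> \bar R}.
Implicit Types phi : L2fun mu.

Section density.
Context (D Rg : set X) (f g : X -> X) (Phi Psi : X -> R).
Hypothesis fb : branch mu D Rg f Phi.
Hypothesis gb : branch mu Rg D g Psi.
Hypothesis gf : {ae mu, forall x, D x -> g (f x) = x}.

Let w x : \bar R := ((Phi x)%:E * (Psi (f x))%:E)%E.

Let measurable_comp_f (k : X -> \bar R) : measurable_fun setT k -> measurable_fun D (k \o f).
Proof. by move=> mk; apply: measurable_comp mk (branch_measurable fb). Qed.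

Let mw : measurable_fun D w.
Proof.
apply: emeasurable_funM; first exact: branch_density_measurable fb D.
exact: (measurable_comp_f (branch_density_measurable gb (A := setT))).
Qed.

Let w_ge0 x : (0 <= w x)%E.
Proof. by rewrite mule_ge0 ?(branch_density_ge0 fb) ?(branch_density_ge0 gb). Qed.

(** Change variables in [Psi * \1_B] with [B] the part of [Rg] that [g] sends into [E]. Since
    [g (f x) = x] almost everywhere, [\1_B \o f] is [\1_E] on [D], and the integral of [Psi] over
    [B] is [mu E]. Thus [w] integrates like the constant 1. *)
Let integral_w (E : set X) : measurable E -> E `<=` D -> (\int[mu]_(x in E) w x = mu E)%E.
Proof.
move=> mE ED; pose B := Rg `&` g @^-1` E.
have mB : measurable B by exact: branch_preimage_measurable gb E mE.
pose h y : \bar R := ((Psi y)%:E * (\1_B y)%:E)%E.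
have mh : measurable_fun setT h.
  apply: emeasurable_funM; first exact: branch_density_measurable gb setT.
  by apply/measurable_EFinP; exact: measurable_indic.
have h0 y : (0 <= h y)%E by rewrite mule_ge0 ?(branch_density_ge0 gb).
transitivity (\int[mu]_(x in D) ((Phi x)%:E * h (f x)))%E.
  rewrite -{1}(setIidr ED) integral_mkcondr; apply: ae_eq_integral.
  - exact: branch_dom fb.
  - by apply/(measurable_restrict _ mE (branch_dom fb));
      apply: measurable_funS mw; [exact: branch_dom fb | move=> x []].
  - apply: emeasurable_funM; first exact: branch_density_measurable fb D.
    exact: measurable_comp_f mh.
  apply: filterS gf => x gfx Dx; rewrite epatch_indic /h /w /= muleA.
  congr (_ * (_)%:E)%E; rewrite !indicE; congr ((_ : bool)%:R).
  apply/idP/idP => /set_mem.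
    by move=> Ex; apply/mem_set; split; [exact: branch_fun fb _ Dx | rewrite /preimage /= gfx].
  by move=> [_]; rewrite /preimage /= gfx// => Ex; exact/mem_set.
rewrite (branch_change_of_variables fb)//.
transitivity (\int[mu]_(x in B) (Psi x)%:E)%E.
  by rewrite integral_mkcondr; apply: eq_integral => y Ry; rewrite !epatch_indic /h /= !indicE in_setI Ry.
by rewrite (branch_integral_preimage gb)// setIidr.
Qed.

(* Without sigma-finiteness, the densities need not be inverse to each other
   almost everywhere: they are so where some square integrable function does
   not vanish, since this set is sigma-finite. *)
Lemma density_inverse phi :
  {ae mu, forall x, D x -> phi x != 0 -> Phi x * Psi (f x) = 1}.
Proof.
(* By Chebyshev's inequality [A n] has finite measure, so the constant 1 is integrable there, and
   equal integrals over all measurable subsets give [w = 1] almost everywhere. The sets [A n]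
   exhaust the part of [D] where [phi] does not vanish. *)
pose A (n : nat) := D `&` [set x | (n.+1%:R^-1%:E <= (normc (phi x) ^+ 2)%:E)%E].
have mA n : measurable (A n).
  apply: measurable_lee => //; first exact: branch_dom fb.
  exact: measurable_funTS (L2fun_measurable_sqr phi).
have finA n : (mu (A n) < +oo)%E.
  have : (n.+1%:R^-1%:E * mu (A n) <= \int[mu]_x (normc (phi x) ^+ 2)%:E)%E.
    rewrite -integral_cst//; apply: le_trans (integral_restrict_le (mA n) phi).
    apply: ge0_le_integral => //.
    - by move=> x _; rewrite lee_fin.
    - exact: measurable_funTS (L2fun_measurable_sqr phi).
    - by move=> x [].
  move/le_lt_trans => /(_ _ (L2fun_sqr_lty phi)); rewrite !ltey; apply: contra_neq => ->.
  by rewrite gt0_muley// lte_fin.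
have wA n : {ae mu, forall x, A n x -> 1%E = w x}.
  apply: (integral_ae_eq (mA n)).
  - apply/integrableP; split; first exact: measurable_cst.
    by under eq_integral do rewrite abse1; rewrite integral_cst// mul1e.
  - by apply: measurable_funS mw => //; [exact: branch_dom fb | exact: subIsetl].
  - move=> E EA mE; rewrite integral_cst// mul1e integral_w//.
    by move=> x /EA[].
apply: filterS (ae_foralln wA) => x wx Dx phi0.
have n0 : 0 < normc (phi x) ^+ 2.
  by rewrite exprn_gt0// lt_def normc_ge0 andbT; apply: contraNneq phi0 => /ComplexField.Normc.eq0_normc ->.
have [n _ /(_ n (leqnn n)) hn] := near_infty_natSinv_lt (PosNum n0).
have /wx : A n x by split => //; rewrite /= lee_fin ltW.
by rewrite /w -EFinM => -[].
Qed.

(** Where [phi] vanishes both sides are 0 whatever the weights; elsewhere [density_inverse] makes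
    the product of the weights equal to 1. *)
Lemma transfer_comp_ae phi :
  {ae mu, forall x, transfer_val D f Phi (transfer_val Rg g Psi phi) x = (\1_D x)%:C%C * phi x}.
Proof.
apply: filterS2 gf (density_inverse phi) => x gfx dens.
rewrite /transfer_val indicE; case: (boolP (x \in D)) => [/set_mem Dx|_] /=; last by rewrite rmorph0 mul0r.
have -> : f x \in Rg by apply/mem_set; exact: branch_fun fb _ Dx.
rewrite gfx// mulrA -rmorphM -sqrtrM ?(RN_ge0 (branch_RN fb))//.
have [->|phi0] := eqVneq (phi x) 0; first by rewrite !mulr0.
by rewrite dens// sqrtr1 rmorph1.
Qed.

Lemma transfer_comp (mD : measurable D) (u : L2 mu) :
  transfer fb (transfer gb u) = restrict_op mD u.
Proof.
rewrite -[u]L2reprK !transferE restrict_opE; apply/eqP/L2class_eqP.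
exact: transfer_comp_ae.
Qed.

End density.

Lemma restrict_op_idem (A : set X) (mA mA' : measurable A) (u : L2 mu) :
  restrict_op mA (restrict_op mA' u) = restrict_op mA u.
Proof.
rewrite -[u]L2reprK !restrict_opE; congr L2class; apply: val_inj; apply/funext => x /=.
by rewrite indicE; case: (x \in A) => /=; rewrite ?rmorph1 ?mul1r// !rmorph0 !mul0r.
Qed.

Lemma restrict_transfer (D Rg : set X) (f : X -> X) (Phi : X -> R)
    (fb : branch mu D Rg f Phi) (mD : measurable D) (u : L2 mu) :
  restrict_op mD (transfer fb u) = transfer fb u.
Proof.
rewrite -[u]L2reprK transferE restrict_opE; congr L2class; apply: val_inj.
apply/funext => x /=; rewrite indicE /transfer_val.
by case: (x \in D) => /=; rewrite ?rmorph1 ?mul1r// rmorph0 mul0r.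
Qed.

(** Linearity extends the equality of norms to [u + a *: v]; the values 1, -1, ['i] and [- 'i] of
    [a] are those that polarization requires. *)
Lemma transfer_ip (D Rg : set X) (f : X -> X) (Phi : X -> R)
    (fb : branch mu D Rg f Phi) (u v : L2 mu) :
  L2_ip mu (transfer fb u) (transfer fb v) =
  L2_ip mu (restrict_op (branch_rng fb) u) (restrict_op (branch_rng fb) v).
Proof.
have iso (a : R[i]) : `|transfer fb u + a *: transfer fb v| =
    `|restrict_op (branch_rng fb) u + a *: restrict_op (branch_rng fb) v|.
  rewrite -transferZ -transferD transfer_isometry; congr (`|_|).
  pose Q := restriction mu (branch_rng fb).
  by rewrite -[LHS]/(op Q (u + a *: v)) opD opZ.
have iso1 := iso 1; rewrite !scale1r in iso1.
have isoN1 := iso (-1); rewrite !scaleN1r in isoN1.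
have isoNi := iso (- 'i%C); rewrite !scaleNr in isoNi.
by rewrite (polarization (L2_ip mu)) iso1 isoN1 iso isoNi -(polarization (L2_ip mu)).
Qed.

Section adjoint.
Context (D Rg : set X) (f g : X -> X) (Phi Psi : X -> R).
Hypothesis fb : branch mu D Rg f Phi.
Hypothesis gb : branch mu Rg D g Psi.
Hypothesis gf : {ae mu, forall x, D x -> g (f x) = x}.

(** Write [S] and [S'] for the two transfers. As [S u] is supported in [D] and [S S' = \1_D], [<S u,
    v> = <S u, \1_D v> = <S u, S S' v> = <\1_Rg u, \1_Rg S' v>], which is [<u, S' v>] because [S' v]
    is supported in [Rg]. *)
Lemma transfer_adj (u v : L2 mu) :
  L2_ip mu (transfer fb u) v = L2_ip mu u (transfer gb v).
Proof.
rewrite -(restrict_transfer fb (branch_dom fb)) restrict_op_adj -(transfer_comp fb gb gf (branch_dom fb)).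
rewrite transfer_ip restrict_op_adj; congr (L2_ip mu u _).
by rewrite restrict_op_idem restrict_transfer.
Qed.

Definition transfer_adjop : adjop (L2_ip mu) :=
  AdjOp transfer_adj (transfer_bounded fb).

End adjoint.
End inverse_branches.

(** * The Cuntz-Krieger family of a branching system *)

Section restriction_algebra.
Context (R : realType) (d : measure_display) (X : measurableType d).
Variable mu : {measure set X -> \bar R}.
Implicit Types A B : set X.

Lemma null_ae_notin A : measurable A -> mu A = 0%E -> {ae mu, forall x, ~ A x}.
Proof. by move=> mA A0; exists A; split=> // x /contrapT. Qed.

Lemma restriction_ae_eq A B (mA : measurable A) (mB : measurable B) :
  ae_seteq mu A B -> restriction mu mA = restriction mu mB.
Proof.
move=> [AB BA]; apply: adjop_ext => u /=; rewrite -[u]L2reprK !restrict_opE.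
apply/eqP/L2class_eqP; apply: filterS2 (null_ae_notin (measurableD mA mB) AB)
  (null_ae_notin (measurableD mB mA) BA) => x ABx BAx /=.
suff -> : \1_A x = \1_B x :> R by [].
rewrite !indicE; congr ((_ : bool)%:R); apply/idP/idP => /set_mem h; apply/mem_set;
  by apply: contrapT => h'; first [by case: ABx | by case: BAx].
Qed.

Lemma restriction0 A (mA : measurable A) : mu A = 0%E -> restriction mu mA = 0.
Proof.
move=> A0; apply: adjop_ext => u; rewrite [LHS]/= -[u]L2reprK restrict_opE.
have z : L2class (0 : L2fun mu) = 0 by rewrite /L2class piE.
apply: etrans z; apply/eqP/L2class_eqP; apply: filterS (null_ae_notin mA A0) => x Ax /=.
by rewrite indicE memNset// rmorph0 mul0r.
Qed.

Lemma restriction_comp A B (mA : measurable A) (mB : measurable B) :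
  adjop_comp (restriction mu mA) (restriction mu mB) = restriction mu (measurableI A B mA mB).
Proof.
apply: adjop_ext => u /=; rewrite -[u]L2reprK !restrict_opE; congr L2class.
apply: val_inj; apply/funext => x /=.
by rewrite mulrA -rmorphM /= indicI.
Qed.

Lemma restriction_setU A B (mA : measurable A) (mB : measurable B)
    (mAB : measurable (A `|` B)) :
  mu (A `&` B) = 0%E -> restriction mu mA + restriction mu mB = restriction mu mAB.
Proof.
move=> AB0; apply: adjop_ext => u; rewrite op_add /= -[u]L2reprK !restrict_opE -L2classD.
apply/eqP/L2class_eqP; apply: filterS (null_ae_notin (measurableI A B mA mB) AB0) => x ABx.
apply: etrans (esym (mulrDl _ _ _)) _; rewrite -rmorphD; congr ((_ : R)%:C%C * _).
rewrite !indicE in_setU.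
case: (boolP (x \in A)) => [/set_mem Ax|_]; case: (boolP (x \in B)) => [/set_mem Bx|_] /=;
  by rewrite ?addr0 ?add0r//; case: ABx.
Qed.

Lemma restriction_sum (I : eqType) (F : I -> set X) (mF : forall i, measurable (F i))
    (s : seq I) (mU : measurable (\big[setU/set0]_(i <- s) F i)) :
  uniq s -> (forall i j, i <> j -> mu (F i `&` F j) = 0%E) ->
  \sum_(i <- s) restriction mu (mF i) = restriction mu mU.
Proof.
move=> + F0; elim: s mU => [|i s ih] mU /=.
  by move=> _; rewrite big_nil restriction0// big_nil measure0.
move=> /andP[ins us]; rewrite big_cons.
have mUs : measurable (\big[setU/set0]_(i <- s) F i) by exact: bigsetU_measurable.
rewrite (ih mUs us); move: mU; rewrite big_cons => mU; apply: restriction_setU.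
have {ih us mU mUs} : forall j, j \in s -> mu (F i `&` F j) = 0%E.
  by move=> j js; apply: F0 => ij; move: ins; rewrite ij js.
(* A second induction shows that [F i] meets the union of the remaining sets in a null set. *)
elim: s {ins} => [|j s ih] hs; first by rewrite big_nil setI0 measure0.
have mUs : measurable (\big[setU/set0]_(i <- s) F i) by exact: bigsetU_measurable.
rewrite big_cons setIUr measureU0//; try exact: measurableI; last first.
  by apply: ih => k ks; apply: hs; rewrite inE ks orbT.
by apply: hs; rewrite mem_head.
Qed.

End restriction_algebra.

HB.instance Definition _ (R : realType) (H : normedModType R[i]) (ip : inner_product H)
    (T : adjop ip) :=
  GRing.isLinear.Build R[i] H H *:%R (op T)
    (fun a x y => etrans (opD T (a *: x) y) (congr1 (+%R^~ (op T y)) (opZ T a x))).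

Lemma op_bounded_complex (R : realType) (H : normedModType R[i]) (ip : inner_product H)
    (T : adjop ip) : exists M : R[i], forall x, `|op T x| <= M * `|x|.
Proof. by have [M hM] := op_bounded T; exists M%:C%C. Qed.

Definition bounded_of_adjop (R : realType) (H : normedModType R[i]) (ip : inner_product H)
    (T : adjop ip) : bounded_operator H :=
  MkBoundedOperator (bounded_operator_fun := op T) (op_bounded_complex T).

Section branching_system_representation.
Context (R : realType) (d : measure_display) (X : measurableType d).
Context (mu : {measure set X -> \bar R}) (E : digraph) (bs : branching_system mu E).
Implicit Types (e : edge E) (v : vertex E).

Lemma bf_branch e :
  branch mu (bD bs (rng e)) (bR bs e) (bf bs e) (bPhi bs e).
Proof.
split; [exact: bD_measurable | exact: bR_measurable | exact: bf_fun
  | exact: bf_measurable | | exact: bf_RN].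
by have [] := bf_onto bs e.
Qed.

(** That [f_e^{-1}] covers [D_(r(e))] up to a null set is derived: almost every [x] there is the
    image of [f_e x]. Measurability of the image, part of the Radon-Nikodym condition, turns
    negligible into measure zero. *)
Lemma bfinv_branch e :
  branch mu (bR bs e) (bD bs (rng e)) (bfinv bs e) (bPhiinv bs e).
Proof.
split; [exact: bR_measurable | exact: bD_measurable | exact: bfinv_fun
  | exact: bfinv_measurable | | exact: bfinv_RN].
apply/negligibleP.
  apply: measurableD; first exact: bD_measurable.
  by have := RN_image (bfinv_RN bs e) (bR_measurable bs e) (@subset_refl _ _).
apply: negligibleS (bfinv_bf bs e) => x [Dx nx] /(_ Dx) gfx; apply: nx.
by exists (bf bs e x) => //; exact: bf_fun.
Qed.

(** The generator lives on [R_e] and composes with [f_e^{-1}], so the inverse branch is the first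
    argument and [f_e] provides the adjoint. *)
Definition bs_isometry e : adjop (L2_ip mu) :=
  transfer_adjop (bfinv_branch e) (bf_branch e) (bf_bfinv bs e).

Definition bs_projection v : adjop (L2_ip mu) := restriction mu (bD_measurable bs v).

Lemma bs_range_proj e : range_proj (bs_isometry e) = restriction mu (bR_measurable bs e).
Proof.
apply: adjop_ext => u.
exact: (transfer_comp (bfinv_branch e) (bf_branch e) (bf_bfinv bs e)).
Qed.

Lemma bs_ck_family : ck_family bs_projection bs_isometry.
Proof.
split.
- move=> v; split; apply: adjop_ext => u //; exact: restrict_op_idem.
- move=> u v uv; rewrite [LHS]restriction_comp restriction0//.
  by have [h _] := bD_disjoint bs uv; rewrite /ae_subset setD0 in h.
- move=> e; apply: adjop_ext => u.
  apply: etrans (transfer_comp (bfinv_branch e) (bf_branch e) (bf_bfinv bs e) (bR_measurable bs e) _) _.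
  exact: restrict_transfer.
- move=> e e' ee'; rewrite !bs_range_proj [LHS]restriction_comp restriction0//.
  by have [h _] := bR_disjoint bs (nesym ee'); rewrite /ae_subset setD0 in h.
- move=> e; apply: adjop_ext => u.
  exact: (transfer_comp (bf_branch e) (bfinv_branch e) (bfinv_bf bs e)).
- move=> e; rewrite bs_range_proj.
  pose mD := bD_measurable bs (src e); pose mR := bR_measurable bs e.
  have mDR := measurableD mD mR.
  have mU := measurableU _ _ mDR mR.
  (* Since [R_e] lies almost everywhere in [D_(s(e))], the difference is the restriction to
     [D_(s(e))] minus [R_e], a projection [q], and [q = q^* q] is positive. *)
  exists (restriction mu mDR); rewrite [RHS](_ : _ = restriction mu mDR); last first.
    by apply: adjop_ext => u; exact: restrict_op_idem.
  apply/eqP; rewrite subr_eq (restriction_setU mDR mR mU); last by rewrite setDKI measure0.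
  apply/eqP/restriction_ae_eq; split; rewrite /ae_subset.
    rewrite -(measure0 mu); congr (mu _); apply/seteqP; split=> // x [Dx].
    by case; case: (pselect (bR bs e x)) => h; [right|left].
  rewrite -(bR_src bs e); congr (mu _); apply/seteqP; split=> x [].
    by move=> [[]|].
  by move=> Rx Dx; split=> //; right.
- move=> v [vn vf]; rewrite fsbig_finite//=.
  under eq_bigr do rewrite bs_range_proj.
  have mU : measurable (\big[setU/set0]_(e <- fset_set (out_edges v)) bR bs e).
    by apply: bigsetU_measurable => e _; exact: bR_measurable.
  rewrite (restriction_sum _ mU)//.
    apply: restriction_ae_eq.
    by rewrite -bigcup_fset_set//; exact: bD_regular.
  move=> e e' ee'.
  by have [h _] := bR_disjoint bs (nesym ee'); rewrite /ae_subset setD0 in h.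
Qed.

End branching_system_representation.

Theorem theorem2p2 (R : realType) (d : measure_display) (X : measurableType d)
    (mu : {measure set X -> \bar R}) (E : digraph) (bs : branching_system mu E)
    (CE : cstarType R) (P : vertex E -> CE) (S : edge E -> CE)
    (hCE : graph_cstar_algebra P S) :
  exists pi : CE -> bounded_operator (L2 mu),
    [/\ star_rep pi,
        forall (e : edge E) (phi : L2fun mu),
          {ae mu, forall x, L2repr (pi (S e) (L2class phi)) x =
            if x \in bR bs e
            then (Num.sqrt (bPhiinv bs e x))%:C%C * phi (bfinv bs e x)
            else 0}
      & forall (v : vertex E) (phi : L2fun mu),
          {ae mu, forall x, L2repr (pi (P v) (L2class phi)) x =
            (\1_(bD bs v) x)%:C%C * phi x}].

Proof.
have [h [hh hP hS]] := gca_universal hCE (bs_ck_family bs).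
exists (fun a => bounded_of_adjop (h a)); split.
- split => [a b phi|c a phi|a b phi|a phi psi].
  + by rewrite /= (star_homD hh).
  + by rewrite /= (star_homZ hh).
  + by rewrite /= (star_homM hh).
  (* The operator underlying [cstar (h a)] is the [adj] field of [h a], so the Hilbert space adjoint
     relation is the one stored in [adjop]. *)
  + by rewrite /= (star_homS hh); exact: (adjPr (h a)).
- move=> e phi; rewrite /= hS /= transferE; exact: L2class_repr.
- move=> v phi; rewrite /= hP /= restrict_opE; exact: L2class_repr.
Qed.
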